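(* Let two $\omega$-convergent sequences $\{g^0_k\}$ and $\{g^1_k\}$ in $\mathcal{M}$, with $\omega$-limits $[g_0]$ and $[g_1]$ respectively, be given. If $\{g^0_k\}$ and $\{g^1_k\}$ are equivalent, i.e., if $$\lim_{k\to\infty}d(g^0_k,g^1_k)=0,$$ then $[g_0]=[g_1]$.
   Context: $M$ is a closed, orientable, $n$-dimensional $C^\infty$ manifold. $\mathcal{S}$ is the Fréchet space of smooth symmetric $(0,2)$-tensor fields on $M$ and $\mathcal{M}\subset\mathcal{S}$ the open subset of smooth Riemannian metrics, so $T_{\tilde g}\mathcal{M}\cong\mathcal{S}$. The $L^2$ metric on $\mathcal{M}$ is the weak Riemannian metric $(h,k)_{\tilde g}=\int_M \mathrm{tr}(\tilde g^{-1}h\tilde g^{-1}k)\,d\mu_{\tilde g}$, and $d$ is its distance function (infimum of lengths of paths in $\mathcal{M}$), which is known to be a metric. Fix a reference metric $g\in\mathcal{M}$; ''nullset'' and ''almost everywhere'' refer to $\mu_g$. A semimetric is a (not necessarily continuous) section $\tilde g$ of $S^2T^*M$ that is positive semidefinite on each $T_xM$. Its deflated set is $X_{\tilde g}=\{x\in M: \tilde g(x)\text{ is not positive definite}\}$. Let $\mathcal{M}_m$ be the set of measurable semimetrics on $M$. On $\mathcal{M}_m$ put $g_0\sim g_1$ iff $X_{g_0}$ and $X_{g_1}$ differ at most by a nullset and $g_0(x)=g_1(x)$ for a.e. $x\in M\setminus(X_{g_0}\cup X_{g_1})$. Put $\widehat{\mathcal{M}_m}=\mathcal{M}_m/{\sim}$.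 For a sequence $\{g_k\}\subset\mathcal{M}$ let $G_k=g^{-1}g_k$ and let $D_{\{g_k\}}=\{x\in M:\forall\delta>0\ \exists k\in\mathbb{N}\text{ with }\det G_k(x)<\delta\}$ be its deflated set. The sequence $\{g_k\}$ $\omega$-converges to $[g_\infty]\in\widehat{\mathcal{M}_m}$ (its $\omega$-limit) if for every representative $g_\infty$: (1) $\{g_k\}$ is $d$-Cauchy; (2) $X_{g_\infty}$ and $D_{\{g_k\}}$ differ at most by a nullset; (3) $g_k(x)\to g_\infty(x)$ for a.e. $x\in M\setminus D_{\{g_k\}}$; (4) $\sum_{k=1}^\infty d(g_k,g_{k+1})<\infty$. *)

(* Defs.v *)
From HB Require Import structures.
From mathcomp Require Import all_boot all_order all_algebra.
From mathcomp Require Import all_classical all_reals all_analysis.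

Set Implicit Arguments.
Unset Strict Implicit.
Unset Printing Implicit Defensive.

Import Order.TTheory GRing.Theory Num.Theory.
Import numFieldNormedType.Exports.

Local Open Scope classical_set_scope.
Local Open Scope ring_scope.

Section euclidean.
Variable R : realType.

Definition tcons n (tx : n.-tuple (measurableTypeR R) * measurableTypeR R) :
  n.+1.-tuple (measurableTypeR R) := [tuple of tx.2 :: tx.1].

Lemma measurable_tcons n : measurable_fun setT (@tcons n).
Proof.
by apply: measurable_cons; [exact: measurable_snd | exact: measurable_fst].
Qed.

Section product.
Variable n : nat.
Variable mu : {measure set (n.-tuple (measurableTypeR R)) -> \bar R}.

Definition lebesgue_cons : set (n.+1.-tuple (measurableTypeR R)) -> \bar R :=
  pushforward (mu \x @lebesgue_measure R)%E (@tcons n).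

HB.instance Definition _ := Measure.copy lebesgue_cons
  (measure_function_pushforward__canonical__measure_function_Measure
    (mu \x @lebesgue_measure R)%E (@measurable_tcons n)).

End product.

(* Lebesgue measure on the Borel sets of R^n, as an n-fold product. It lives on
   tuples, which carry the product sigma-algebra; row vectors carry the
   topology, and [row_of_tuple] identifies the two. *)
Fixpoint lebesgue_tuple n :
    {measure set (n.-tuple (measurableTypeR R)) -> \bar R} :=
  if n is m.+1 then lebesgue_cons (lebesgue_tuple m) else \d_ [tuple].

Definition row_of_tuple n (t : n.-tuple (measurableTypeR R)) : 'rV[R]_n :=
  \row_i tnth t i.

Definition lebesgue_int n (D : set 'rV[R]_n) (f : 'rV[R]_n -> \bar R) : \bar R :=
  (\int[lebesgue_tuple n]_(t in @row_of_tuple n @^-1` D) f (row_of_tuple t))%E.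

Definition partial n (W : normedModType R) (i : 'I_n) (f : 'rV[R]_n -> W) :
  'rV[R]_n -> W := fun y => 'D_(delta_mx 0 i) f y.

Definition partials n (W : normedModType R) (s : seq 'I_n)
  (f : 'rV[R]_n -> W) : 'rV[R]_n -> W := foldr (fun i h => partial i h) f s.

(* C^infinity on V (meant for V open) *)
Definition smooth_on n (W : normedModType R) (V : set 'rV[R]_n)
    (f : 'rV[R]_n -> W) : Prop :=
  forall (s : seq 'I_n) y, V y ->
    {for y, continuous (partials s f)} /\
    forall i, derivable (partials s f) y (delta_mx 0 i).

Definition bilin n (A : 'M[R]_n) (v w : 'rV[R]_n) : R := (v *m A *m w^T) 0 0.

Definition sympsd n (A : 'M[R]_n) : Prop :=
  A^T = A /\ forall v, 0 <= bilin A v v.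

Definition posdef n (A : 'M[R]_n) : Prop :=
  forall v, v != 0 -> 0 < bilin A v v.

End euclidean.

Section manifold.
Variables (R : realType) (n : nat).

(* [to_coord] and [of_coord] are total; only their restrictions to
   [chart_dom] and [chart_img] are meaningful. *)
Record chart (M : topologicalType) := Chart {
  chart_dom : set M;
  chart_img : set 'rV[R]_n;
  to_coord : M -> 'rV[R]_n;
  of_coord : 'rV[R]_n -> M;
  chart_dom_open : open chart_dom;
  chart_img_open : open chart_img;
  to_coord_img : forall x, chart_dom x -> chart_img (to_coord x);
  of_coord_dom : forall y, chart_img y -> chart_dom (of_coord y);
  to_coordK : forall x, chart_dom x -> of_coord (to_coord x) = x;
  of_coordK : forall y, chart_img y -> to_coord (of_coord y) = y;
  to_coord_cont : forall x, chart_dom x -> {for x, continuous to_coord};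
  of_coord_cont : forall y, chart_img y -> {for y, continuous of_coord} }.

Definition overlap (M : topologicalType) (c c' : chart M) : set 'rV[R]_n :=
  chart_img c `&` of_coord c @^-1` chart_dom c'.

Definition transition (M : topologicalType) (c c' : chart M) :
  'rV[R]_n -> 'rV[R]_n := to_coord c' \o of_coord c.

Definition smooth_compat (M : topologicalType) (c c' : chart M) : Prop :=
  smooth_on (overlap c c') (transition c c') /\
  smooth_on (overlap c' c) (transition c' c).

(* The smooth structure is the one generated by a finite smooth atlas, which
   exists by compactness. Second countability is then automatic. *)
Record closedManifold := ClosedManifold {
  carrier :> topologicalType;
  carrier_hausdorff : hausdorff_space carrier;
  carrier_compact : compact [set: carrier];
  atlas_size : nat;
  atlas : 'I_atlas_size -> chart carrier;
  atlas_cover : forall x : carrier, exists i, chart_dom (atlas i) x;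
  atlas_compat : forall i j, smooth_compat (atlas i) (atlas j) }.

Definition orientable (M : closedManifold) : Prop :=
  exists A : set (chart M),
    [/\ forall c i, A c -> smooth_compat c (atlas i),
        forall x : M, exists2 c, A c & chart_dom c x
      & forall c c', A c -> A c' -> forall y, overlap c c' y ->
          0 < \det ('J (transition c c') y)].

Variable M : closedManifold.

(* The first chart of the atlas containing x; its coordinates identify T_x M
   with R^n. *)
Definition chart_at (x : M) : 'I_(atlas_size M) :=
  [arg min_(i < sval (cid (atlas_cover x)) | `[< chart_dom (atlas i) x >]) i]%N.

(* A (not necessarily continuous) section of T^*M (x) T^*M: [s x] is the matrix
   of the bilinear form on T_x M in the coordinates of [chart_at x]. *)
Definition tensor_field := M -> 'M[R]_n.

(* The matrix of components of s in the i-th chart, at the point with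
   coordinates y. As 'J acts on row vectors from the right, pulling a bilinear
   form S back along J gives J *m S *m J^T. *)
Definition components (i : 'I_(atlas_size M)) (s : tensor_field) (y : 'rV[R]_n) :
    'M[R]_n :=
  let x := of_coord (atlas i) y in
  let J := 'J (transition (atlas i) (atlas (chart_at x))) y in
  J *m s x *m J^T.

Definition smooth_sym : set tensor_field :=
  [set s | (forall x, (s x)^T = s x) /\
           forall i, smooth_on (chart_img (atlas i)) (components i s)].

Definition metrics : set tensor_field :=
  [set s | smooth_sym s /\ forall x, posdef (s x)].

(* Integral of f against the volume measure of g: the sets
   {chart_at = i} are a Borel partition of M subordinate to the atlas. *)
Definition vol_int (g : tensor_field) (f : M -> \bar R) : \bar R :=
  (\sum_(i < atlas_size M)
    lebesgue_int
      (chart_img (atlas i) `&` [set y | chart_at (of_coord (atlas i) y) = i])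
      (fun y => f (of_coord (atlas i) y)
                * (Num.sqrt (\det (components i g y)))%:E))%E.

Definition vol (g : tensor_field) (A : set M) : \bar R :=
  vol_int g (fun x => (\1_A x)%:E).

Definition borel : set (set M) := <<s [set A : set M | open A] >>.

Definition nullset (g : tensor_field) (N : set M) : Prop :=
  exists B, [/\ borel B, vol g B = 0%E & N `<=` B].

Definition aeM (g : tensor_field) (P : M -> Prop) : Prop :=
  nullset g [set x | ~ P x].

Definition lebesgue_measurable (g : tensor_field) (A : set M) : Prop :=
  exists B N, [/\ borel B, nullset g N & A = B `|` N].

Definition measurable_section (g s : tensor_field) : Prop :=
  forall (i : 'I_(atlas_size M)) (j k : 'I_n) (Y : set (measurableTypeR R)),
    measurable Y ->
    lebesgue_measurable g (chart_dom (atlas i) `&`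
      [set x | Y (components i s (to_coord (atlas i) x) j k)]).

(* From here on, a g that only enters through null sets, or through the
   relative determinant, is the fixed reference metric. *)
Definition measurable_semimetrics (g : tensor_field) : set tensor_field :=
  [set s | (forall x, sympsd (s x)) /\ measurable_section g s].

Definition deflated (s : tensor_field) : set M := [set x | ~ posdef (s x)].

Definition semimetric_eq (g s0 s1 : tensor_field) : Prop :=
  nullset g (deflated s0 `+` deflated s1) /\
  aeM g (fun x => ~ (deflated s0 `|` deflated s1) x -> s0 x = s1 x).

Definition semimetric_class (g s : tensor_field) : set tensor_field :=
  [set s' | measurable_semimetrics g s' /\ semimetric_eq g s' s].

Definition semimetric_quotient (g : tensor_field) : set (set tensor_field) :=
  semimetric_class g @` measurable_semimetrics g.

(* Values in \bar R; they are finite on smooth fields since M is compact. *)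
Definition l2_inner (g h k : tensor_field) : \bar R :=
  vol_int g (fun x => (\tr (invmx (g x) *m h x *m invmx (g x) *m k x))%:E).

Definition l2_norm (g h : tensor_field) : \bar R := (l2_inner g h h `^ 2^-1)%E.

(* Convergence in the Frechet topology of [smooth_sym]: uniform convergence of
   all partial derivatives on compact subsets of the charts. *)
Definition frechet_cvg (T : Type) (F : set_system T) (h : T -> tensor_field)
    (l : tensor_field) : Prop :=
  forall (i : 'I_(atlas_size M)) (s : seq 'I_n) (K : set 'rV[R]_n) (e : R),
    compact K -> K `<=` chart_img (atlas i) -> 0 < e ->
    \forall t \near F, forall y, K y ->
      `|partials s (components i (h t)) y - partials s (components i l) y| < e.

(* c is a C^1 curve [a, b] -> [smooth_sym] with derivative c'. *)
Definition C1_curve (a b : R) (c c' : R -> tensor_field) : Prop :=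
  forall t, t \in `[a, b] ->
    [/\ smooth_sym (c t), smooth_sym (c' t),
        frechet_cvg (within [set e | t + e \in `[a, b]] 0^')
          (fun e x => e^-1 *: (c (t + e) x - c t x)) (c' t)
      & frechet_cvg (within [set u | u \in `[a, b]] (nbhs t)) c' (c' t)].

(* c is a piecewise C^1 path [0, 1] -> [metrics] from g0 to g1, and c' is its
   derivative except at the finitely many breakpoints, where c' is arbitrary. *)
Definition metric_path (g0 g1 : tensor_field) (c c' : R -> tensor_field) : Prop :=
  [/\ c 0 = g0, c 1 = g1, forall t, t \in `[0, 1] -> metrics (c t)
    & exists s : seq R, [/\ path <%R 0 s, last 0 s = 1
      & forall k, (k < size s)%N ->
        let a := nth 0 (0 :: s) k in let b := nth 0 s k in
        exists2 dc, C1_curve a b c dc &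
          forall t, t \in `]a, b[ -> c' t = dc t]].

Definition path_length (c c' : R -> tensor_field) : \bar R :=
  (\int[@lebesgue_measure R]_(t in `[0%R, 1%R]) l2_norm (c t) (c' t))%E.

Definition l2_dist (g0 g1 : tensor_field) : \bar R :=
  ereal_inf [set l | exists c c', metric_path g0 g1 c c' /\ l = path_length c c'].

Definition deflated_seq (g : tensor_field) (gk : nat -> tensor_field) : set M :=
  [set x | forall delta : R, 0 < delta ->
     exists k, \det (invmx (g x) *m gk k x) < delta].

Definition omega_cvg (g : tensor_field) (gk : nat -> tensor_field) (C : set tensor_field) :
    Prop :=
  semimetric_quotient g C /\
  forall ginf, C ginf ->
    [/\ forall e : R, 0 < e -> exists N, forall k l, (N <= k)%N -> (N <= l)%N ->
          (l2_dist (gk k) (gk l) < e%:E)%E,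
        nullset g (deflated ginf `+` deflated_seq g gk),
        aeM g (fun x => ~ deflated_seq g gk x -> gk k x @[k --> \oo] --> ginf x)
      & (\sum_(0 <= k <oo) l2_dist (gk k) (gk k.+1) < +oo)%E].

End manifold.

(* Main.v *)
Require Import Defs.
From HB Require Import structures.
From mathcomp Require Import all_boot all_order all_algebra.
From mathcomp Require Import all_classical all_reals all_analysis.
From mathcomp Require Import perm measurable_realfun ring lra.

Set Implicit Arguments.
Unset Strict Implicit.
Unset Printing Implicit Defensive.

Import Order.TTheory GRing.Theory Num.Theory.
Import numFieldNormedType.Exports.

Local Open Scope classical_set_scope.
Local Open Scope ring_scope.

(** The two limits agree because the L2 distance controls, in L1 over bounded parts
of the charts, the variation of enough scalar functions of the metric.

At a point of a chart, a metric is a positive definite matrix A, and the integrand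
of the L2 metric at a tangent vector h is [speed2 A h], the trace of (A^-1 h)^2
times the square root of det A. For a vector v, let [probe v A] be the fourth root
of det A divided by 1 + A(v, v). Two applications of the Cauchy-Schwarz inequality,
[mxtrace_le] and [bilin_le], together with Jacobi's formula [is_derive_det], bound
the derivative of a probe in the direction h by a constant times [speed A h]
([derive_probe_le]).

Let c be a path of metrics and let Y be a part of finite Lebesgue measure of a chart.
Integrating the pointwise bound along the path and over Y, exchanging the two
integrals by Tonelli's theorem ([integral_probe_le]), and applying Cauchy-Schwarz on
Y yields a bound for the integral over Y of the increment of a probe by a constant
times the length of c. Hence it is also bounded by a constant times the L2 distance
of the end points ([probe_increment_le_dist]). The joint measurability that Tonelli's
theorem requires holds since velocities are continuous in time at each point and
continuous in space at each time ([caratheodory_measurable]).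

Let two equivalent omega-convergent sequences be given. The distances of
consecutive terms are summable, so at almost every point the fourth root of the
determinant converges along each sequence ([ae_probe_cvg]); the limit is 0 exactly on
the deflated set of the sequence ([deflated_seqP]). The distances between the two
sequences tend to 0, so by Fatou's lemma the lower limit of the difference of any
probe is 0 almost everywhere ([ae_probe_liminf]). Taking v = 0, the two limits of the
fourth root of the determinant coincide, and so do the deflated sets up to a null set.
At almost every other point both sequences converge to positive definite matrices
with the same probes, and finitely many probes determine such a matrix
([probe_inj]).

Null sets of M are translated into Lebesgue-null sets of the pieces of charts over
which the volume is integrated ([nullsetP]); there no change of coordinates is
involved ([components_piece]). *)

(** * Inner products on symmetric tensors at a point *)

Section posdef_matrices.
Variable R : realType.

Lemma posdef_unit n (A : 'M[R]_n) : posdef A -> A \in unitmx.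
Proof.
move=> Apos; rewrite -row_free_unit -kermx_eq0; apply/negPn/negP.
case/rowV0Pn => v /sub_kermxP vA /Apos.
by rewrite /bilin vA mul0mx mxE ltxx.
Qed.

(** One step of symmetric Gaussian elimination; it lowers by one the size of the
matrix that remains to be factored. *)
Lemma schur_complement n (a : R) (b : 'rV[R]_n) (D : 'M[R]_n) : a != 0 ->
  let P := block_mx 1%:M 0 (- (a^-1 *: b^T)) 1%:M : 'M[R]_(1 + n) in
  P *m block_mx a%:M b b^T D *m P^T
  = block_mx a%:M 0 0 (D - a^-1 *: (b^T *m b)).
Proof.
move=> a0 /=; rewrite (tr_block_mx (1%:M : 'M[R]_1)) !mulmx_block /=.
rewrite !trmx1 !trmx0 !mul1mx !mulmx1 !mul0mx !mulmx0 !addr0.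
rewrite linearN /= linearZ /= trmxK.
have E1 : - (a^-1 *: b^T) *m a%:M + b^T = 0.
  by rewrite mulNmx mul_mx_scalar scalerA mulfV // scale1r addNr.
have E2 : a%:M *m - (a^-1 *: b) + b = 0.
  by rewrite mulmxN mul_scalar_mx scalerA mulfV // scale1r addNr.
by rewrite E1 E2 mul0mx add0r mulNmx -scalemxAl [D + _]addrC [_ + D]addrC.
Qed.

(** Cholesky factorisation, by induction on the size through the Schur
complement. *)
Lemma posdef_factor n (A : 'M[R]_n) : A^T = A -> posdef A ->
  exists2 Q, Q \in unitmx & A = Q *m Q^T.
Proof.
elim: n A => [|n IH] A Asym Apos.
  by exists 1%:M; rewrite ?unitmx1 // [LHS]flatmx0 [RHS]flatmx0.
move: A Asym Apos; rewrite -[n.+1]/(1 + n)%N => A Asym Apos.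
set a := A 0 0; set b := ursubmx A; set D := drsubmx A.
have AE : A = block_mx a%:M b b^T D.
  rewrite -[LHS]submxK; congr block_mx.
    apply/matrixP => i j; rewrite !mxE !ord1 eqxx mulr1n.
    by congr (A _ _); apply/val_inj.
  by rewrite /b trmx_ursub Asym.
have DT : D^T = D by rewrite /D trmx_drsub Asym.
have a_gt0 : 0 < a.
  have := Apos (delta_mx 0 0); rewrite /bilin -rowE trmx_delta -colE !mxE.
  apply; apply/eqP => /matrixP /(_ 0 0) /eqP.
  by rewrite !mxE eqxx oner_eq0.
have a0 : a != 0 by rewrite gt_eqF.
have := @schur_complement n a b D a0; rewrite -AE.
set P := block_mx _ _ _ _; set S := D - _ => PAP.
have Punit : P \in unitmx.
  by rewrite unitmxE /P (det_lblock (1%:M : 'M[R]_1)) !det1 mulr1 unitr1.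
have ST : S^T = S.
  by rewrite /S linearB /= linearZ /= trmx_mul trmxK DT.
have Spos : posdef S.
  move=> v v0; pose w := row_mx (0 : 'rV[R]_1) v *m P.
  have w0 : w != 0.
    apply: contraNneq v0 => /(congr1 (mulmx^~ (invmx P))).
    rewrite mul0mx /w mulmxK // => /eqP.
    by rewrite row_mx_eq0 => /andP[].
  suff -> : bilin S v v = bilin A w w by exact: Apos.
  rewrite /bilin /w trmx_mul !mulmxA -(mulmxA (row_mx _ _)) -(mulmxA _ _ P^T).
  rewrite PAP tr_row_mx trmx0 mul_row_block mul_row_col !(mul0mx, mulmx0).
  by rewrite !add0r.
have [Q Qunit SQ] := IH _ ST Spos.
pose Q2 := block_mx (Num.sqrt a)%:M 0 0 Q : 'M[R]_(1 + n).
have Q2unit : Q2 \in unitmx.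
  rewrite unitmxE /Q2 (det_ublock ((Num.sqrt a)%:M : 'M[R]_1)) det_scalar1.
  by rewrite unitrM -unitmxE Qunit andbT unitfE gt_eqF // sqrtr_gt0.
have Q2E : Q2 *m Q2^T = block_mx a%:M 0 0 S.
  rewrite /Q2 (tr_block_mx ((Num.sqrt a)%:M : 'M[R]_1)) mulmx_block.
  rewrite !trmx0 !(mul0mx, mulmx0) !addr0 add0r -SQ tr_scalar_mx.
  by rewrite -scalar_mxM -expr2 sqr_sqrtr // ltW.
exists (invmx P *m Q2); first by rewrite unitmx_mul unitmx_inv Punit.
rewrite trmx_mul -mulmxA (mulmxA Q2) Q2E -PAP !mulmxA.
by rewrite mulVmx // mul1mx -mulmxA -trmx_mul mulVmx // trmx1 mulmx1.
Qed.

Lemma posdef_det_gt0 n (A : 'M[R]_n) : A^T = A -> posdef A -> 0 < \det A.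
Proof.
move=> Asym /(posdef_factor Asym)[Q Qu ->].
rewrite det_mulmx det_tr -expr2 exprn_even_gt0 //=.
by rewrite -unitfE -unitmxE.
Qed.

Lemma mxtrace_sqr_ge0 n (S : 'M[R]_n) : S^T = S -> 0 <= \tr (S *m S).
Proof.
move=> ST; rewrite /mxtrace sumr_ge0 // => i _; rewrite mxE sumr_ge0 // => j _.
by rewrite -{2}ST mxE -expr2 sqr_ge0.
Qed.

(** The inner product that A induces on symmetric bilinear forms: the integrand of
the L2 metric, without its volume density. *)
Definition tensor_inner n (A h k : 'M[R]_n) : R :=
  \tr (invmx A *m h *m invmx A *m k).

(** If A = Q Q^T, then the substitution S = Q^-1 h Q^-T turns the trace into the
sum of the squares of the entries of S. *)
Lemma tensor_inner_ge0 n (A h : 'M[R]_n) : A^T = A -> posdef A -> h^T = h ->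
  0 <= tensor_inner A h h.
Proof.
move=> Asym Apos hsym; have [Q Qu AQ] := posdef_factor Asym Apos.
have QTu : Q^T \in unitmx by rewrite unitmx_tr.
have -> : tensor_inner A h h =
    \tr ((invmx Q *m h *m (invmx Q)^T) *m (invmx Q *m h *m (invmx Q)^T)).
  rewrite /tensor_inner.
  have -> : invmx A = (invmx Q)^T *m invmx Q.
    have Au := posdef_unit Apos.
    rewrite -[RHS]mul1mx -(mulVmx Au) AQ -!mulmxA (mulmxA Q^T).
    by rewrite -trmx_mul mulVmx // trmx1 mul1mx mulmxV // mulmx1.
  by rewrite -!mulmxA mxtrace_mulC !mulmxA.
by apply: mxtrace_sqr_ge0; rewrite !trmx_mul trmxK hsym mulmxA.
Qed.

Lemma discriminant_le (a b d : R) : 0 <= d ->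
  (forall c, 0 <= a - 2 * c * b + c ^+ 2 * d) -> b ^+ 2 <= a * d.
Proof.
rewrite le_eqVlt => /predU1P[<-|d0] H.
  rewrite mulr0 leNgt; apply/negP; rewrite exprn_even_gt0 //= => b0.
  have := H ((a + 1) / (2 * b)).
  have -> : a - 2 * ((a + 1) / (2 * b)) * b + ((a + 1) / (2 * b)) ^+ 2 * 0 = -1.
    by field.
  by rewrite ler0N1.
have := H (b / d).
have -> : a - 2 * (b / d) * b + (b / d) ^+ 2 * d = (a * d - b ^+ 2) / d.
  by field; rewrite gt_eqF.
by rewrite pmulr_lge0 ?invr_gt0 // subr_ge0.
Qed.

Lemma tensor_inner_cauchy n (A h k : 'M[R]_n) :
  A^T = A -> posdef A -> h^T = h -> k^T = k ->
  tensor_inner A h k ^+ 2 <= tensor_inner A h h * tensor_inner A k k.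
Proof.
move=> As Ap hs ks; apply: discriminant_le; first exact: tensor_inner_ge0.
move=> c; have : 0 <= tensor_inner A (h - c *: k) (h - c *: k).
  by apply: tensor_inner_ge0; rewrite // linearB /= linearZ /= hs ks.
set rhs := (X in _ -> 0 <= X).
rewrite {1}/tensor_inner !(mulmxBr, mulmxBl) -!scalemxAr -!scalemxAl.
rewrite !linearB /= !linearZ /=.
rewrite -/(tensor_inner A h k) -/(tensor_inner A h h).
have -> : \tr (invmx A *m k *m invmx A *m h) = tensor_inner A h k.
  by rewrite /tensor_inner -mulmxA mxtrace_mulC mulmxA.
rewrite -/(tensor_inner A k k); move=> hk_ge0.
apply: le_trans hk_ge0 _; rewrite /rhs /GRing.scale /= le_eqVlt.
by apply/orP; left; apply/eqP; ring.
Qed.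

(** Cauchy-Schwarz, since the trace of h is the inner product of h with A itself
and A has squared norm n. *)
Lemma mxtrace_le n (A h : 'M[R]_n) : A^T = A -> posdef A -> h^T = h ->
  \tr (invmx A *m h) ^+ 2 <= n%:R * tensor_inner A h h.
Proof.
move=> As Ap hs; have Au := posdef_unit Ap.
have := tensor_inner_cauchy As Ap hs As.
have -> : tensor_inner A A A = n%:R.
  by rewrite /tensor_inner mulVmx // mul1mx mulVmx // mxtrace1.
have -> : tensor_inner A h A = \tr (invmx A *m h).
  by rewrite /tensor_inner -mulmxA mulVmx // mulmx1.
by rewrite mulrC.
Qed.

(** Cauchy-Schwarz again: h(v, v) is the inner product of h with the square of the
covector A v, whose norm is A(v, v). *)
Lemma bilin_le n (A h : 'M[R]_n) (v : 'rV[R]_n) :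
  A^T = A -> posdef A -> h^T = h ->
  bilin h v v ^+ 2 <= tensor_inner A h h * bilin A v v ^+ 2.
Proof.
move=> As Ap hs; have Au := posdef_unit Ap.
pose K := A *m v^T *m v *m A.
have Ks : K^T = K by rewrite /K !trmx_mul trmxK As !mulmxA.
have E k : tensor_inner A k K = bilin k v v.
  rewrite /tensor_inner /K -!mulmxA (mulmxA (invmx A) A) mulVmx // mul1mx.
  rewrite mxtrace_mulC -!mulmxA mulmxV // mulmx1 mulmxA mxtrace_mulC.
  by rewrite mulmxA /bilin /mxtrace big_ord_recl big_ord0 addr0.
have := tensor_inner_cauchy As Ap hs Ks; rewrite !E.
have -> // : bilin K v v = bilin A v v ^+ 2.
have KE : v *m K *m v^T = (v *m A *m v^T) *m (v *m A *m v^T).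
  by rewrite /K !mulmxA.
by rewrite /bilin KE mxE big_ord_recl big_ord0 addr0 expr2.
Qed.

End posdef_matrices.

(** * Probes of a positive definite matrix *)

Section volume_root.
Variable R : realType.
Implicit Types t : R.

Lemma is_derive_prod (I : eqType) (s : seq I) (f : I -> R -> R) (df : I -> R) t :
  uniq s -> (forall i, is_derive t 1 (f i) (df i)) ->
  is_derive t 1 (fun u => \prod_(i <- s) f i u)
    (\sum_(k <- s) df k * \prod_(i <- s | i != k) f i t).
Proof.
move=> us fd; elim: s us => [_|i s IH /= /andP[nis us]].
  rewrite big_nil; under eq_fun do rewrite big_nil.
  exact: is_derive_cst.
have -> : (fun u => \prod_(j <- i :: s) f j u) =
    f i * (fun u => \prod_(j <- s) f j u).
  by apply/funext => u; rewrite big_cons.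
have := IH us => IHs; apply: is_derive_eq.
rewrite big_cons big_cons eqxx /= addrC /GRing.scale /=; congr (_ + _).
  rewrite mulrC; congr (_ * _); rewrite big_seq_cond [RHS]big_seq_cond.
  apply: eq_bigl => j; case: eqP => [->|] /=; last by rewrite andbT.
  by rewrite (negbTE nis).
rewrite mulr_sumr !big_seq; apply: eq_bigr => k ks.
rewrite big_cons ifT; last by apply: contraNneq nis => ->.
by rewrite mulrCA.
Qed.

(** Jacobi's formula. By the Leibniz expansion, the derivative is the sum of the
determinants in which one row of A is replaced with the same row of A'; expanding
these along the replaced row gives the adjugate. *)
Lemma is_derive_det n (A : R -> 'M[R]_n) (A' : 'M[R]_n) t :
  (forall i j, is_derive t 1 (fun u => A u i j) (A' i j)) ->
  A t \in unitmx ->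
  is_derive t 1 (fun u => \det (A u)) (\det (A t) * \tr (invmx (A t) *m A')).
Proof.
move=> dA Au.
pose B k : 'M[R]_n := \matrix_(i, j) if i == k then A' i j else A t i j.
have -> : \det (A t) * \tr (invmx (A t) *m A') = \sum_k \det (B k).
  have -> : invmx (A t) = (\det (A t))^-1 *: \adj (A t) by rewrite /invmx Au.
  rewrite -scalemxAl mxtraceZ mulrA mulfV ?mul1r; last first.
    by rewrite -unitfE -unitmxE.
  rewrite mxtrace_mulC; apply: eq_bigr => k _; rewrite mxE.
  rewrite (expand_det_row _ k); apply: eq_bigr => j _.
  rewrite /B !mxE eqxx; congr (_ * _); rewrite /cofactor; congr (_ * \det _).
  by apply/matrixP => i l; rewrite !mxE eq_sym (negbTE (neq_lift _ _)).
have -> : (fun u => \det (A u)) =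
    \sum_(s : 'S_n) (fun u => (-1) ^+ s * \prod_i A u i (s i)).
  by apply/funext => u; rewrite /determinant fct_sumE.
have -> : \sum_k \det (B k) = \sum_(s : 'S_n) (-1) ^+ s *
    (\sum_k A' k (s k) * \prod_(i | i != k) A t i (s i)).
  under [RHS]eq_bigr do rewrite mulr_sumr.
  rewrite [RHS]exchange_big /=; apply: eq_bigr => k _.
  rewrite /determinant; apply: eq_bigr => s _.
  congr (_ * _); rewrite (bigD1 k) //= mxE eqxx; congr (_ * _).
  by apply: eq_bigr => i /negbTE ik; rewrite mxE ik.
elim/big_ind2 : _ => [|u du v dv ? ?|s _]; [exact: is_derive_cst|exact: is_deriveD|].
have := @is_derive_prod _ (index_enum 'I_n) (fun i u => A u i (s i))
  (fun i => A' i (s i)) t (index_enum_uniq _) (fun i => dA i (s i)) => dP.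
exact: is_deriveZ.
Qed.

Definition fourth_root (x : R) := Num.sqrt (Num.sqrt x).

(** The square of the norm of a tangent vector h at A, as a density with respect
to the coordinate volume. *)
Definition speed2 n (A h : 'M[R]_n) := tensor_inner A h h * Num.sqrt (\det A).

Definition speed n (A h : 'M[R]_n) := Num.sqrt (speed2 A h).

(** These functions separate positive definite matrices. The power 1/4 of the
determinant is the one whose variation compares with [speed], where the square
root of the volume density appears; the second factor brings in A(v, v) through
a function that has a bounded derivative with respect to the logarithm of
A(v, v). *)
Definition probe n (v : 'rV[R]_n) (A : 'M[R]_n) :=
  fourth_root (\det A) / (1 + bilin A v v).

Lemma is_derive_fourth_root (x : R) : 0 < x ->
  is_derive x 1 fourth_root (fourth_root x / (4 * x)).
Proof.
move=> x0; have sx0 : 0 < Num.sqrt x by rewrite sqrtr_gt0.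
have d1 := is_derive1_sqrt x0.
have d2 := is_derive1_sqrt sx0.
have H := is_derive1_comp d2 d1; rewrite /comp -/fourth_root in H.
 apply: is_derive_eq.
have : Num.sqrt (Num.sqrt x) ^+ 2 = Num.sqrt x by rewrite sqr_sqrtr // ltW.
have : Num.sqrt x ^+ 2 = x by rewrite sqr_sqrtr // ltW.
have : 0 < Num.sqrt (Num.sqrt x) by rewrite sqrtr_gt0.
rewrite /fourth_root; move: (Num.sqrt (Num.sqrt x)) => r r0 E2 E1.
rewrite -[in RHS]E2 -E1.
by rewrite /GRing.scale /=; field; rewrite gt_eqF.
Qed.

Lemma is_derive_bilin n (v : 'rV[R]_n) (A : R -> 'M[R]_n) (A' : 'M[R]_n) t :
  (forall i j, is_derive t 1 (fun u => A u i j) (A' i j)) ->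
  is_derive t 1 (fun u => bilin (A u) v v) (bilin A' v v).
Proof.
move=> dA.
have E (B : 'M[R]_n) :
    bilin B v v = \sum_(j < n) \sum_(i < n) (v 0 j * v 0 i) * B i j.
  rewrite /bilin mxE; apply: eq_bigr => j _; rewrite !mxE mulr_suml.
  by apply: eq_bigr => i _; ring.
rewrite E; under eq_fun do rewrite E.
have -> : (fun u => \sum_(j < n) \sum_(i < n) (v 0 j * v 0 i) * A u i j) =
    \sum_(j < n) \sum_(i < n) (fun u => (v 0 j * v 0 i) * A u i j).
  by apply/funext => u; rewrite fct_sumE; apply: eq_bigr => j _; rewrite fct_sumE.
apply: is_derive_sum => j; apply: is_derive_sum => i; exact: is_deriveZ.
Qed.

Lemma norm_le_of_sqr (x y : R) : 0 <= y -> x ^+ 2 <= y ^+ 2 -> `|x| <= y.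
Proof. by move=> y0 xy; rewrite -(ler_pXn2r (n := 2)) ?nnegrE // real_normK ?num_real. Qed.

(** The probes are Lipschitz for the pointwise L2 geometry: the logarithmic
derivative of the volume is a trace, and the relative variation of A(v, v) is
at most the norm of h, while x / (1 + x) ^ 2 is bounded. *)
Lemma derive_probe_le n (v : 'rV[R]_n) (A : R -> 'M[R]_n) (A' : 'M[R]_n) t :
  (forall i j, is_derive t 1 (fun u => A u i j) (A' i j)) ->
  (A t)^T = A t -> posdef (A t) -> A'^T = A' ->
  exists2 d, is_derive t 1 (fun u => probe v (A u)) d &
    `|d| <= n.+2%:R * speed (A t) A'.
Proof.
move=> dA As Ap A's.
have det0 := posdef_det_gt0 As Ap.
have d1 := is_derive_det dA (posdef_unit Ap).
have d2 := is_derive_fourth_root det0.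
have d12 : is_derive t 1 (fun u => fourth_root (\det (A u)))
    (fourth_root (\det (A t)) * \tr (invmx (A t) *m A') / 4).
  have H := is_derive1_comp d2 d1; rewrite /comp in H; apply: is_derive_eq.
  by rewrite /GRing.scale /=; field; rewrite gt_eqF.
have d3 := is_derive_bilin v dA.
have s0 : 0 <= bilin (A t) v v.
  have [->|v0] := eqVneq v 0; first by rewrite /bilin !mul0mx mxE.
  by rewrite ltW // Ap.
have tr_le := mxtrace_le As Ap A's.
have bi_le := bilin_le v As Ap A's.
have N0 := tensor_inner_ge0 As Ap A's.
have q0 : 0 <= fourth_root (\det (A t)) by rewrite sqrtr_ge0.
have speedE : speed (A t) A' =
    Num.sqrt (tensor_inner (A t) A' A') * fourth_root (\det (A t)).
  by rewrite /speed /speed2 sqrtrM.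
set q := fourth_root _ in speedE q0 d12 *.
set s := bilin (A t) v v in s0 d3 bi_le *.
set T := \tr _ in d12 tr_le *.
set s' := bilin A' v v in d3 bi_le *.
have d4 : is_derive t 1 (fun u => 1 + bilin (A u) v v) s'.
  rewrite -[s']add0r.
  exact: (@is_deriveD _ _ _ (cst (1 : R)) (fun u => bilin (A u) v v)).
have s1 : 1 + s != 0 by rewrite gt_eqF // ltr_wpDr.
have d5 := @is_deriveV _ (fun u => 1 + bilin (A u) v v) t s' 1 s1 d4.
have d6 := is_deriveM d12 d5.
exists (q * T / 4 / (1 + s) - q * s' / (1 + s) ^+ 2).
  apply: is_derive_eq; rewrite /GRing.scale /= -/s -/q.
  by field.
rewrite speedE; set N := Num.sqrt _.
have N2 : N ^+ 2 = tensor_inner (A t) A' A' by rewrite sqr_sqrtr.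
have N00 : 0 <= N by rewrite sqrtr_ge0.
have T_le : `|T| <= n.+1%:R * N.
  apply: norm_le_of_sqr; first by rewrite mulr_ge0.
  rewrite exprMn N2 (le_trans tr_le) // ler_wpM2r // -natrX ler_nat.
  by rewrite -mulnn (leq_trans (leqnSn n)) // leq_pmulr.
have s'_le : `|s'| <= N * s.
  apply: norm_le_of_sqr; first by rewrite mulr_ge0.
  by rewrite exprMn N2.
have i1 : (1 + s)^-1 <= 1 by rewrite invf_le1 ?lerDl // ltr_wpDr.
have i0 : 0 <= (1 + s)^-1 by rewrite invr_ge0 addr_ge0.
apply: le_trans (ler_normB _ _) _.
rewrite !normrM !normrV ?unitfE //; last by rewrite expf_neq0.
rewrite normrX (ger0_norm q0) [`|1 + s|]ger0_norm ?addr_ge0 // [`|4|]ger0_norm //.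
have -> : n.+2%:R * (N * q) = q * (n.+1%:R * N) + q * N.
  by rewrite -[n.+2]addn1 natrD; ring.
apply: lerD.
  rewrite -!mulrA ler_wpM2l // (le_trans _ T_le) // ler_piMr //.
  have : (4^-1 : R) <= 1 by lra.
  by nra.
rewrite -mulrA ler_wpM2l // (le_trans (ler_wpM2r _ s'_le)) //.
  by rewrite invr_ge0 exprn_ge0 // addr_ge0.
rewrite -mulrA ler_piMr // ler_pdivrMr ?mul1r; first by nra.
by rewrite exprn_gt0 // ltr_wpDr.
Qed.

End volume_root.

(** * Continuity, measurability and increments of functions *)

Section function_classes.
Variables (R : realType) (T : Type).

(** Continuous functions and measurable functions are handled at once through
the closure properties that they share. *)
Record function_class (P : set (T -> R)) : Prop := FunctionClass {
  class_cst : forall c, P (fun=> c);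
  class_add : forall f h, P f -> P h -> P (fun t => f t + h t);
  class_mul : forall f h, P f -> P h -> P (fun t => f t * h t);
  class_inv : forall f, P f -> (forall t, f t != 0) -> P (fun t => (f t)^-1);
  class_sqrt : forall f, P f -> P (fun t => Num.sqrt (f t)) }.

Variables (P : set (T -> R)) (PP : function_class P).

Lemma class_sum (I : Type) (s : seq I) (p : pred I) (f : I -> T -> R) :
  (forall i, P (f i)) -> P (fun t => \sum_(i <- s | p i) f i t).
Proof.
move=> fP; elim: s => [|i s IH].
  by under eq_fun do rewrite big_nil; exact: class_cst.
under eq_fun do rewrite big_cons.
by case: (p i) => //; exact: class_add.
Qed.

Lemma class_prod (I : Type) (s : seq I) (p : pred I) (f : I -> T -> R) :
  (forall i, P (f i)) -> P (fun t => \prod_(i <- s | p i) f i t).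
Proof.
move=> fP; elim: s => [|i s IH].
  by under eq_fun do rewrite big_nil; exact: class_cst.
under eq_fun do rewrite big_cons.
by case: (p i) => //; exact: class_mul.
Qed.

Definition class_mx m n (A : T -> 'M[R]_(m, n)) :=
  forall i j, P (fun t => A t i j).

Lemma class_det n (A : T -> 'M[R]_n) : class_mx A -> P (fun t => \det (A t)).
Proof.
move=> AP; apply: class_sum => s; apply: class_mul => //.
  exact: class_cst.
by apply: class_prod => i; exact: AP.
Qed.

Lemma class_mulmx m n p (A : T -> 'M[R]_(m, n)) (B : T -> 'M[R]_(n, p)) :
  class_mx A -> class_mx B -> class_mx (fun t => A t *m B t).
Proof.
move=> AP BP i j; under eq_fun do rewrite mxE.
by apply: class_sum => k; apply: (class_mul PP); [exact: AP|exact: BP].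
Qed.

Lemma class_invmx n (A : T -> 'M[R]_n) : (forall t, A t \in unitmx) ->
  class_mx A -> class_mx (fun t => invmx (A t)).
Proof.
move=> Au AP i j.
under eq_fun do rewrite /invmx Au !mxE.
apply: class_mul => //; first apply: class_inv => //; first exact: class_det.
  by move=> t; rewrite -unitfE -unitmxE.
apply: class_mul => //; first exact: class_cst.
by apply: class_det => k l; under eq_fun do rewrite !mxE; exact: AP.
Qed.

Lemma class_speed n (A A' : T -> 'M[R]_n) : (forall t, A t \in unitmx) ->
  class_mx A -> class_mx A' -> P (fun t => speed (A t) (A' t)).
Proof.
move=> Au AP A'P; apply: class_sqrt => //; apply: class_mul => //.
  have iAP := class_invmx Au AP.
  apply: class_sum => i; have iAA'P := class_mulmx iAP A'P.
  exact: (class_mulmx (class_mulmx iAA'P iAP) A'P).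
by apply: class_sqrt => //; exact: class_det.
Qed.

Lemma class_bilin n (v : 'rV[R]_n) (A : T -> 'M[R]_n) : class_mx A ->
  P (fun t => bilin (A t) v v).
Proof.
move=> AP; have cstP m p (B : 'M[R]_(m, p)) : class_mx (fun=> B).
  by move=> i j; exact: class_cst.
exact: (class_mulmx (class_mulmx (cstP _ _ v) AP) (cstP _ _ v^T)).
Qed.

Lemma class_probe n (v : 'rV[R]_n) (A : T -> 'M[R]_n) : class_mx A ->
  (forall t, posdef (A t)) -> P (fun t => probe v (A t)).
Proof.
move=> AP Ap; apply: class_mul => //.
  by do 2 apply: class_sqrt => //; exact: class_det.
apply: class_inv => //.
  by apply: class_add => //; [exact: class_cst|exact: class_bilin].
move=> t; rewrite gt_eqF // ltr_wpDr //.
have [->|v0] := eqVneq v 0; first by rewrite /bilin !mul0mx mxE.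
by rewrite ltW // Ap.
Qed.

End function_classes.

Lemma continuous_class (R : realType) (T : topologicalType) :
  function_class [set f : T -> R | continuous f].
Proof.
split=> [c|f h cf ch|f h cf ch|f cf f0|f cf] /=.
- exact: cst_continuous.
- by move=> t; exact: cvgD (cf t) (ch t).
- by move=> t; exact: cvgM (cf t) (ch t).
- by move=> t; apply: cvgV => //; exact: cf.
- by move=> t; apply: continuous_comp; [exact: cf|exact: sqrt_continuous].
Qed.

Lemma measurable_class (R : realType) d (T : measurableType d) (D : set T) :
  function_class [set f : T -> R | measurable_fun D f].
Proof.
split=> [c|f h mf mh|f h mf mh|f mf f0|f mf] /=.
- exact: measurable_cst.
- exact: measurable_funD.
- exact: measurable_funM.
- apply: (measurable_comp (F := [set x : R | x != 0])) mf => //.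
  + exact: open_measurable.
  + by move=> _ [t _ <-]; exact: f0.
  + apply: open_continuous_measurable_fun => //.
    by move=> x; rewrite inE /= => x0; exact: inv_continuous.
- apply: measurableT_comp mf; apply: continuous_measurable_fun.
  exact: sqrt_continuous.
Qed.

Section real_line.
Variable R : realType.
Notation mu := (@lebesgue_measure R).

(** Comparison of the increment of phi with the integral of a continuous bound
of its derivative: both F + phi and F - phi are nondecreasing, where F is the
primitive of the bound. *)
Lemma increment_le_integral (phi rho : R -> R) (a b : R) : a < b ->
  continuous phi -> continuous rho -> (forall t, 0 <= rho t) ->
  (forall t, t \in `]a, b[ -> exists2 d, is_derive t 1 phi d & `|d| <= rho t) ->
  (`|phi b - phi a|%:E <= \int[mu]_(t in `[a, b]) (rho t)%:E)%E.
Proof.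
move=> ab cphi crho rho0 dphi.
have irho : mu.-integrable `[a, b] (EFin \o rho).
  apply: continuous_compact_integrable; first exact: segment_compact.
  exact: continuous_subspaceT.
pose F x := (\int[mu]_(t in `[a, x]) rho t)%R.
have dF x : x \in `]a, b[ -> is_derive x 1 F (rho x).
  rewrite in_itv /= => /andP[ax xb].
  have [dFx FE] := continuous_FTC1_closed xb irho ax (crho x).
  by rewrite -FE derive1E; exact/derivableP.
have cF : {within `[a, b], continuous F}.
  exact: (parameterized_integral_continuous (ltW ab) irho).
have Fa : F a = 0 by rewrite /F set_itv1 Rintegral_set1.
have aab : a \in `[a, b] by rewrite in_itv /= lexx ltW.
have bab : b \in `[a, b] by rewrite in_itv /= lexx ltW.
have step (e : R) : (e = 1 \/ e = -1) -> e * (phi b - phi a) <= F b.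
  move=> e1; pose H x := F x - e * phi x.
  have dH x : x \in `]a, b[ -> exists2 d, is_derive x 1 H d & 0 <= d.
    move=> xab; have [d dphix dle] := dphi x xab; have dFx := dF x xab.
    exists (rho x - e * d).
      have de := @is_deriveZ _ _ _ phi e x 1 d dphix.
      exact: is_deriveB.
    rewrite subr_ge0 (le_trans _ dle) // (le_trans (ler_norm _)) // normrM.
    by case: e1 => ->; rewrite ?normrN normr1 mul1r.
  have : H a <= H b.
    apply: (@ger0_derive1_le_cc _ H a b) => //; last exact: ltW.
    - by move=> x /dH[d dHx _]; exact: ex_derive.
    - by move=> x /dH[d dHx d0]; rewrite derive1E derive_val.
    - move=> x; apply: cvgB; first exact: cF.
      apply: cvgM; first exact: cvg_cst.
      by have := @continuous_subspaceT _ _ `[a, b] phi cphi; apply.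
  by rewrite /H Fa; lra.
have : `|phi b - phi a| <= F b.
  have := step 1 (or_introl erefl); have := step (-1) (or_intror erefl).
  by move=> ? ?; rewrite ler_norml; apply/andP; split; lra.
rewrite -lee_fin => /le_trans; apply.
rewrite /F /Rintegral fineK //; first exact: integrable_fin_num.
Qed.

End real_line.

(** * Families of metrics over a measure space *)

Section caratheodory.
Variables (R : realType) (d : measure_display) (X : measurableType d).

(** By continuity in the first variable, the function is the limit of those obtained
by rounding that variable down to the multiples of 1 / m, and each of these is
measurable on every one of countably many strips. *)
Lemma caratheodory_measurable (f : R -> X -> R) :
  (forall t, measurable_fun setT (f t)) ->
  (forall x, continuous (f^~ x)) ->
  measurable_fun setT (fun p : measurableTypeR R * X => f p.1 p.2).
Proof.
move=> mf cf.
pose q m (t : R) : R := (Num.floor (t * m.+1%:R))%:~R / m.+1%:R.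
have q_cvg t : q m t @[m --> \oo] --> t.
  apply/cvgrPdist_le => e e0; near=> m.
  have m0 : (0 : R) < m.+1%:R by [].
  have -> : t - q m t = (t * m.+1%:R - (Num.floor (t * m.+1%:R))%:~R) / m.+1%:R.
    by rewrite mulrBl mulfK // gt_eqF.
  have /andP[le_t lt_t] := floor_itv (t * m.+1%:R).
  rewrite ger0_norm; last by rewrite divr_ge0 // subr_ge0.
  apply: (@le_trans _ _ m.+1%:R^-1).
    rewrite ler_piMl ?invr_ge0 // lerBlDl ltW //.
    by move: lt_t; rewrite intrD1 // addrC.
  apply/ltW; near: m; exact: near_infty_natSinv_lt (PosNum e0).
apply: (@measurable_fun_cvg _ _ _ setT
  (fun m (p : measurableTypeR R * X) => f (q m p.1) p.2)); last first.
  by move=> [t x] _ /=; exact: continuous_cvg (cf x t) (q_cvg t).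
move=> m _ B mB; rewrite setTI.
have -> : (fun p : measurableTypeR R * X => f (q m p.1) p.2) @^-1` B =
  \bigcup_(z : int) ([set t : measurableTypeR R | Num.floor (t * m.+1%:R) = z]
     `*` (f (z%:~R / m.+1%:R) @^-1` B)).
  apply/seteqP; split => [[t x] /= Bf|[t x] [z _ [/= tz]]].
    by exists (Num.floor (t * m.+1%:R)).
  by rewrite /q tz.
apply: countable_bigcupT_measurable => // z; apply: measurableX.
  have m0 : (0 : R) < m.+1%:R by [].
  have -> : [set t : measurableTypeR R | Num.floor (t * m.+1%:R) = z] =
      `[z%:~R / m.+1%:R, (z + 1)%:~R / m.+1%:R[%classic.
    apply/seteqP; split => t /=; rewrite in_itv /= ler_pdivrMr // ltr_pdivlMr //.
      by move=> <-; exact: floor_itv.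
    by move=> tz; exact: floor_def.
  exact: measurable_itv.
by rewrite -[X in measurable X]setTI; exact: mf.
Unshelve. all: by end_near. Qed.

End caratheodory.

Section metric_families.
Variables (R : realType) (n : nat) (d : measure_display) (X : measurableType d).
Variable mu : {sigma_finite_measure set X -> \bar R}.
Notation leb := (@lebesgue_measure R).

(** Pointwise increments are bounded by pointwise lengths, and the integral over
X of the pointwise lengths is, by Tonelli, the integral over time of the
L1-norm of the velocity. *)
Lemma integral_probe_le (v : 'rV[R]_n) (A A' : R -> X -> 'M[R]_n) (a b : R) :
  a < b ->
  (forall t x, (A t x)^T = A t x) -> (forall t x, posdef (A t x)) ->
  (forall t x, (A' t x)^T = A' t x) ->
  (forall t, class_mx [set f | measurable_fun setT f] (A t)) ->
  (forall t, class_mx [set f | measurable_fun setT f] (A' t)) ->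
  (forall x, class_mx [set f : R -> R | continuous f] (A^~ x)) ->
  (forall x, class_mx [set f : R -> R | continuous f] (A'^~ x)) ->
  (forall x t i j, t \in `]a, b[ ->
    is_derive t 1 (fun u => A u x i j) (A' t x i j)) ->
  let S t := (\int[mu]_x (speed (A t x) (A' t x))%:E)%E in
  measurable_fun [set: measurableTypeR R] S /\
  (\int[mu]_x `|probe v (A b x) - probe v (A a x)|%:E <=
    n.+2%:R%:E * \int[leb]_(t in `[a, b]) S t)%E.
Proof.
move=> ab As Ap A's mA mA' cA cA' dA S.
have Au t x := posdef_unit (Ap t x).
pose r t x := speed (A t x) (A' t x).
have r0 t x : 0 <= r t x by rewrite sqrtr_ge0.
have mr t : measurable_fun setT (r t).
  exact: (class_speed (measurable_class R (@setT X))).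
have cr x : continuous (r^~ x).
  exact: (class_speed (continuous_class R R) (A := A^~ x)).
have mrr := caratheodory_measurable mr cr.
have mrrE : measurable_fun setT
    (fun p : measurableTypeR R * X => (r p.1 p.2)%:E) by exact/measurable_EFinP.
split.
  apply: (measurable_fun_fubini_tonelli_F (m2 := mu)
    (fun p : measurableTypeR R * X => (r p.1 p.2)%:E) mrrE) => p.
  by rewrite lee_fin.
pose D : set (measurableTypeR R) := `[a, b]%classic.
have mD : measurable D by exact: measurable_itv.
pose F := (fun p : measurableTypeR R * X => (r p.1 p.2)%:E) \_ (D `*` setT).
have mF : measurable_fun setT F.
  apply/(measurable_restrictT _ _).1; first exact: measurableX.
  exact: measurable_funTS.
have F0 p : (0 <= F p)%E.
  by apply: erestrict_ge0 => q _; rewrite lee_fin.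
have FE t x : F (t, x) = ((fun t => (r t x)%:E) \_ D) t.
  rewrite /F !patchE; congr (if _ then _ else _).
  by apply/idP/idP; rewrite !inE /=; [case|split].
have -> : (\int[leb]_(t in `[a, b]) S t = \int[leb]_t \int[mu]_x F (t, x))%E.
  rewrite [LHS]integral_mkcond; apply: eq_integral => t _.
  under [RHS]eq_integral do rewrite FE.
  rewrite patchE; case: ifPn => tD.
    by apply: eq_integral => x _; rewrite patchE tD.
  by rewrite [RHS]integral0_eq // => x _; rewrite patchE (negbTE tD).
rewrite fubini_tonelli //.
have mG : measurable_fun setT (fun x => \int[leb]_t F (t, x))%E.
  exact: (measurable_fun_fubini_tonelli_G (m1 := leb) F mF F0).
rewrite -ge0_integralZl //; last by move=> x _; exact: integral_ge0.
have mprobe t : measurable_fun setT (fun x => probe v (A t x)).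
  exact: (class_probe (measurable_class R (@setT X))).
apply: ge0_le_integral => //.
- by apply/measurable_EFinP; apply: measurableT_comp => //; exact: measurable_funB.
- by apply: emeasurable_funM => //; exact: measurable_cst.
move=> x _.
have -> : (\int[leb]_t F (t, x) = \int[leb]_(t in `[a, b]) (r t x)%:E)%E.
  rewrite [RHS]integral_mkcond; apply: eq_integral => t _; exact: FE.
rewrite -ge0_integralZl //=; last 2 first.
- apply/measurable_EFinP; apply: measurable_funTS.
  by apply: continuous_measurable_fun; exact: cr.
- by move=> t _; rewrite lee_fin.
under eq_integral do rewrite -EFinM.
apply: (@increment_le_integral R (fun t => probe v (A t x))
  (fun t => n.+2%:R * r t x)) => //.
- exact: (class_probe (continuous_class R R) v (A := A^~ x)).
- by move=> t; apply: cvgM; [exact: cvg_cst|exact: cr].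
- by move=> t; rewrite mulr_ge0.
move=> t tab; exact: (derive_probe_le v (fun i j => dA x t i j tab)).
Qed.

End metric_families.

(** * Lebesgue measure on tuples and row vectors *)

Section sigma_finite_copy.
Variables (R : realType) (d : measure_display) (T : measurableType d).
Variable mu : {measure set T -> \bar R}.

(** The measure mu under a name that carries the proof of its sigma-finiteness, as
Tonelli's theorem requires. *)
Definition sigma_finite_copy of sigma_finite setT mu : set T -> \bar R := mu.

Variable mu_sigma_finite : sigma_finite setT mu.

HB.instance Definition _ := Measure.copy (sigma_finite_copy mu_sigma_finite) mu.
HB.instance Definition _ :=
  @Measure_isSigmaFinite.Build _ _ _ (sigma_finite_copy mu_sigma_finite)
    mu_sigma_finite.

End sigma_finite_copy.

Section lebesgue_on_tuples.
Variable R : realType.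

Definition tuple_of_row n (y : 'rV[R]_n) : n.-tuple (measurableTypeR R) :=
  [tuple y 0 i | i < n].

Lemma tuple_of_rowK n : cancel (@tuple_of_row n) (@row_of_tuple R n).
Proof. by move=> y; apply/rowP => i; rewrite mxE tnth_mktuple. Qed.

Lemma row_of_tupleK n : cancel (@row_of_tuple R n) (@tuple_of_row n).
Proof. by move=> t; apply: eq_from_tnth => i; rewrite tnth_mktuple mxE. Qed.

Lemma sigma_finite_lebesgue_tuple n :
  sigma_finite setT (lebesgue_tuple R n : set _ -> \bar R).
Proof.
elim: n => [|n IH].
  exists (fun=> setT) => [|i]; first by rewrite bigcup_const.
  by split => //=; rewrite diracT ltry.
have /sigma_finiteP[F [FT F_nd Ffin]] := IH.
have /sigma_finiteP[G [GT G_nd Gfin]] := sigma_finiteT (@lebesgue_measure R).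
pose untcons (t : n.+1.-tuple (measurableTypeR R)) := ([tuple of behead t], thead t).
have tconsK : cancel (@tcons R n) untcons.
  by move=> [t x]; rewrite /untcons /tcons /= theadE; congr (_, _); apply: val_inj.
have muntcons : measurable_fun setT untcons.
  apply/measurable_fun_pairP; split; first exact: measurable_behead.
  exact: (measurable_tnth (T := measurableTypeR R) ord0).
exists (fun k => untcons @^-1` (F k `*` G k)).
  apply/seteqP; split=> // t _.
  have : [set: n.-tuple (measurableTypeR R)] (untcons t).1 by [].
  have : [set: measurableTypeR R] (untcons t).2 by [].
  rewrite FT GT => -[l _ Gl] [k _ Fk].
  exists (maxn k l) => //; split.
    by have /subsetPset := F_nd _ _ (leq_maxl k l); apply.
  by have /subsetPset := G_nd _ _ (leq_maxr k l); apply.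
move=> k; have [mF Fk] := Ffin k; have [mG Gk] := Gfin k; split.
  by rewrite -[X in measurable X]setTI; apply: muntcons => //; exact: measurableX.
rewrite /= /lebesgue_cons /pushforward -comp_preimage.
rewrite (_ : untcons \o @tcons R n = id); last by apply/funext => p; exact: tconsK.
rewrite preimage_id product_measure1E //.
by rewrite lte_mul_pinfty // ge0_fin_numE.
Qed.

Definition lebn n := sigma_finite_copy (@sigma_finite_lebesgue_tuple n).

Definition rat_box n (q : n.-tuple rat) (r : rat) : set 'rV[R]_n :=
  [set y | forall i, `|y 0 i - ratr (tnth q i)| < ratr r].

Lemma rat_box_in_open n (U : set 'rV[R]_n) y : open U -> U y ->
  exists q r, rat_box q r `<=` U /\ rat_box q r y.
Proof.
rewrite openE => /[apply] /nbhs_ballP[e /= e0 eU].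
have e2 : 0 < e / 2 by rewrite divr_gt0.
have [r] := rat_in_itvoo e2; rewrite in_itv /= => /andP[r0 re].
have qP i : exists q : rat, `|y 0 i - ratr q| < ratr r.
  have [|q] := @rat_in_itvoo R (y 0 i - ratr r) (y 0 i + ratr r); first by lra.
  rewrite in_itv /= => /andP[q1 q2]; exists q.
  by rewrite ltr_norml; apply/andP; split; lra.
pose q := [tuple sval (cid (qP i)) | i < n].
have qy : rat_box q r y by move=> i; rewrite tnth_mktuple; case: cid.
exists q, r; split=> // z qz; apply: eU; split=> // i j; rewrite !ord1 /ball /=.
have := qy j; have := qz j; rewrite !ltr_norml => /andP[? ?] /andP[? ?].
by apply/andP; split; lra.
Qed.

(** An open set is the union of the rational boxes that it contains, and these are
countably many. *)
Lemma measurable_row_open n (U : set 'rV[R]_n) : open U ->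
  measurable (@row_of_tuple R n @^-1` U).
Proof.
move=> oU.
pose B (p : n.-tuple rat * rat) := if `[< rat_box p.1 p.2 `<=` U >]
  then rat_box p.1 p.2 else set0.
have -> : U = \bigcup_p B p.
  apply/seteqP; split=> [y Uy|y [p _]].
    have [q [r [qU qy]]] := rat_box_in_open oU Uy.
    by exists (q, r) => //; rewrite /B /=; case: asboolP.
  by rewrite /B; case: asboolP => // + qy; apply.
rewrite preimage_bigcup; apply: countable_bigcupT_measurable => // p.
rewrite /B; case: ifP => _; last by rewrite preimage_set0.
have -> : @row_of_tuple R n @^-1` rat_box p.1 p.2 =
    \bigcap_(i in [set: 'I_n]) ((tnth (T := measurableTypeR R))^~ i @^-1`
      [set x : measurableTypeR R | `|x - ratr (tnth p.1 i)| < ratr p.2]).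
  apply/seteqP; split=> t /= H i => [_|]; first by have := H i; rewrite mxE.
  by have := H i I; rewrite mxE.
apply: fin_bigcap_measurable => // i _.
rewrite -[X in measurable X]setTI; apply: measurable_tnth => //.
have -> : [set x : measurableTypeR R | `|x - ratr (tnth p.1 i)| < ratr p.2] =
    ball (ratr (tnth p.1 i) : R) (ratr p.2).
  by apply/seteqP; split=> x; rewrite /ball /= distrC.
exact: measurable_ball.
Qed.

Lemma open_setI_preimage (T S : topologicalType) (V : set T) (f : T -> S)
    (B : set S) : open V -> (forall y, V y -> {for y, continuous f}) ->
  open B -> open (V `&` f @^-1` B).
Proof.
rewrite !openE => oV cf oB y [Vy By]; apply: filterI; first exact: oV.
by apply: cf => //; exact: oB.
Qed.

Lemma measurable_row_continuous n (V : set 'rV[R]_n) (f : 'rV[R]_n -> R) :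
  open V -> (forall y, V y -> {for y, continuous f}) ->
  measurable_fun (@row_of_tuple R n @^-1` V) (f \o @row_of_tuple R n).
Proof.
move=> oV cf mD; apply: (measurability _ (RGenOpens.measurableE R)) => //.
move=> _ [_ [a [b ->] <-]].
rewrite (_ : _ `&` _ = @row_of_tuple R n @^-1` (V `&` f @^-1` `]a, b[)) //.
by apply: measurable_row_open; apply: open_setI_preimage => //; exact: interval_open.
Qed.

End lebesgue_on_tuples.

(** * Partition of the manifold into chart pieces *)

Section chart_pieces.
Variables (R : realType) (n : nat) (M : closedManifold R n).
Implicit Types (i : 'I_(atlas_size M)) (s g : tensor_field M).

Lemma chart_atP (x : M) i : chart_at x = i <->
  chart_dom (atlas i) x /\ forall j, chart_dom (atlas j) x -> (i <= j)%N.
Proof.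
rewrite /chart_at; case: cid => /= i0 i0x; case: arg_minnP; first exact/asboolP.
move=> j /asboolP jx jmin; split=> [<-|[ix imin]].
  by split=> // k /asboolP; exact: jmin.
by apply/val_inj/eqP; rewrite eqn_leq jmin ?imin //; exact/asboolP.
Qed.

Lemma chart_dom_at (x : M) : chart_dom (atlas (chart_at x)) x.
Proof. by have /chart_atP[] := erefl (chart_at x). Qed.

(** Coordinates, in the i-th chart, of the points whose distinguished chart is the
i-th one: the domain of integration of the i-th term of [vol_int]. *)
Definition piece i : set 'rV[R]_n :=
  chart_img (atlas i) `&` [set y | chart_at (of_coord (atlas i) y) = i].

Definition tuple_piece i := @row_of_tuple R n @^-1` piece i.

Definition chart_point i (t : n.-tuple (measurableTypeR R)) : M :=
  of_coord (atlas i) (row_of_tuple t).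

Lemma pieceE i : piece i = chart_img (atlas i) `\`
  \bigcup_(j in [set j : 'I_(atlas_size M) | (j < i)%N])
    (chart_img (atlas i) `&` of_coord (atlas i) @^-1` chart_dom (atlas j)).
Proof.
apply/seteqP; split=> y [iy].
  move=> /chart_atP[_ imin]; split=> // -[j /= ji [_ jy]].
  by have := imin _ jy; rewrite leqNgt ji.
move=> notj; split=> //; apply/chart_atP; split=> [|j jy].
  exact: of_coord_dom.
by rewrite leqNgt; apply/negP => ji; apply: notj; exists j.
Qed.

Lemma measurable_tuple_piece i : measurable (tuple_piece i).
Proof.
rewrite /tuple_piece pieceE -[_ `\` _]/(_ `&` ~` _) preimage_setI -preimage_setC.
apply: measurableI; first by apply: measurable_row_open; exact: chart_img_open.
apply: measurableC; rewrite preimage_bigcup.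
apply: fin_bigcup_measurable => [|j _]; first exact: finite_finset.
apply: measurable_row_open; apply: open_setI_preimage.
- exact: chart_img_open.
- by move=> y iy; exact: of_coord_cont.
- exact: chart_dom_open.
Qed.

(** The differential depends only on the germ of the map. *)
Lemma jacobian_id (f : 'rV[R]_n -> 'rV[R]_n) (y : 'rV[R]_n) :
  (\forall z \near y, f z = z) -> 'J f y = 1%:M.
Proof.
move=> fid.
have dE : 'd f y = idfun :> ('rV[R]_n -> 'rV[R]_n).
  apply: diff_unique => [z|]; first exact: cvg_id.
  apply/eqaddoP => e e0.
  have := fid; rewrite (near_shift (0 : 'rV[R]_n)) subr0; apply: filterS => h /= fh.
  rewrite -[X in `|X| <= _]/(f (h + y) - (f y + h)) fh (nbhs_singleton fid).
  rewrite [y + h]addrC subrr.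
  by rewrite normr0 mulr_ge0 // ltW.
by apply/row_matrixP => j; rewrite !rowE mul_rV_lin1 dE mulmx1.
Qed.

(** On its own piece, a chart is its own distinguished chart and no change of
coordinates takes place. *)
Lemma components_piece i s y : piece i y ->
  components i s y = s (of_coord (atlas i) y).
Proof.
move=> [iy /= ci]; rewrite /components ci jacobian_id ?mul1mx ?trmx1 ?mulmx1 //.
have oi : open (chart_img (atlas i)) by exact: chart_img_open.
have : \forall z \near y, chart_img (atlas i) z by exact: open_nbhs_nbhs.
by apply: filterS => z iz; exact: of_coordK.
Qed.

Lemma measurable_piece_entry i s j k : smooth_sym s ->
  measurable_fun (tuple_piece i) (fun t => s (chart_point i t) j k).
Proof.
move=> [_ /(_ i) ss].
have mc : measurable_fun (@row_of_tuple R n @^-1` chart_img (atlas i))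
    ((fun y => components i s y j k) \o @row_of_tuple R n).
  apply: measurable_row_continuous; first exact: chart_img_open.
  move=> y iy; have [cs _] := ss [::] y iy.
  exact: (@continuous_comp _ _ _ (components i s) (fun A : 'M[R]_n => A j k) y cs
    (@coord_continuous _ n n j k _)).
apply: (eq_measurable_fun ((fun y => components i s y j k) \o @row_of_tuple R n)).
  by move=> t /set_mem ti /=; rewrite components_piece.
apply: measurable_funS mc; last by move=> t [].
by apply: measurable_row_open; exact: chart_img_open.
Qed.

End chart_pieces.

(** * Borel sets and null sets of the manifold *)

(** Turns the measurability of a map defined on a chart domain only into a
statement about the generators of the target sigma-algebra. *)
Lemma sigma_algebra_partial_preimage (T S : Type) (G : set (set T)) (D : set T)
    (f : T -> S) : sigma_algebra setT G -> G D ->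
  sigma_algebra setT [set B | G (D `&` f @^-1` B)].
Proof.
move=> [G0 GC GU] GD.
have GCT A : G A -> G (~` A) by move=> GA; rewrite -setTD; exact: GC.
split=> [|A GA|F GF] /=.
- by rewrite preimage_set0 setI0.
- rewrite (_ : _ `&` _ = ~` (~` D `|` (D `&` f @^-1` A))).
    apply: (GCT _); rewrite -bigcup2E; apply: GU => -[|[|k]] //=; exact: GCT.
  apply/seteqP; split=> t /=.
    by move=> [Dt [_ At]] [//|[_ /At]].
  by move=> /not_orP[/contrapT Dt /not_andP[//|At]]; split.
- by rewrite preimage_bigcup setI_bigcupr; exact: GU.
Qed.

Section null_sets.
Variables (R : realType) (n : nat) (M : closedManifold R n).
Implicit Types (i : 'I_(atlas_size M)) (s g : tensor_field M) (N B : set M).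
Notation leb := (lebesgue_tuple R n).

Lemma vol_int_pieces g (f : M -> \bar R) : vol_int g f =
  (\sum_(i < atlas_size M) \int[leb]_(t in tuple_piece i)
    (f (chart_point i t) * (Num.sqrt (\det (g (chart_point i t))))%:E))%E.
Proof.
apply: eq_bigr => i _; apply: eq_integral => t /set_mem ti.
by rewrite components_piece.
Qed.

Lemma metrics_det_gt0 g x : metrics g -> 0 < \det (g x).
Proof. by move=> [[gs _] gp]; exact: posdef_det_gt0. Qed.

Lemma measurable_chart_point i B : borel B ->
  measurable (tuple_piece i `&` chart_point i @^-1` B).
Proof.
have mi := measurable_tuple_piece i.
have oi : measurable (@row_of_tuple R n @^-1` chart_img (atlas i)).
  by apply: measurable_row_open; exact: chart_img_open.
pose D := @row_of_tuple R n @^-1` chart_img (atlas i).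
suff : @borel R n M `<=` [set B | measurable (D `&` chart_point i @^-1` B)].
  move=> /[apply] mB; rewrite (_ : _ `&` _ =
    tuple_piece i `&` (D `&` chart_point i @^-1` B)); first exact: measurableI.
  by apply/seteqP; split=> t /=; [move=> [[? ?] ?]|move=> [? []]].
apply: smallest_sub.
  apply: sigma_algebra_partial_preimage => //.
  by split=> [|A mA|F mF]; [exact: measurable0|rewrite setTD; exact: measurableC|
    exact: bigcupT_measurable].
move=> A /= oA; apply: (measurable_row_open (U := chart_img (atlas i) `&`
  of_coord (atlas i) @^-1` A)).
apply: open_setI_preimage => //; first exact: chart_img_open.
by move=> y iy; exact: of_coord_cont.
Qed.

Lemma borel_open B : open B -> borel B.
Proof. by move=> oB; apply: sub_sigma_algebra. Qed.

Lemma borelC B : borel B -> borel (~` B).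
Proof. by move=> bB; rewrite -setTD; exact: sigma_algebraCD. Qed.

Lemma borel_bigcup (F : (set M)^nat) :
  (forall k, borel (F k)) -> borel (\bigcup_k F k).
Proof. by move=> bF; exact: sigma_algebra_bigcup. Qed.

Lemma borelU B C : borel B -> borel C -> borel (B `|` C).
Proof.
move=> bB bC; rewrite -bigcup2E; apply: borel_bigcup => -[|[|k]] //=.
exact: sigma_algebra0.
Qed.

Lemma borelI B C : borel B -> borel C -> borel (B `&` C).
Proof.
move=> bB bC; rewrite -[_ `&` _]setCK setCI.
by apply: borelC; apply: borelU; exact: borelC.
Qed.

Lemma borel_bigcup_ord (F : 'I_(atlas_size M) -> set M) :
  (forall i, borel (F i)) -> borel (\bigcup_i F i).
Proof.
move=> bF.
pose G k := if insub k is Some i then F i else set0.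
rewrite (_ : \bigcup_i F i = \bigcup_k G k).
  apply: borel_bigcup => k; rewrite /G.
  by case: insubP => // _; exact: sigma_algebra0.
apply/seteqP; split=> x [k _] Fx.
  by exists (val k) => //; rewrite /G valK.
by move: Fx; rewrite /G; case: insubP => // i _ _ Fx; exists i.
Qed.

Lemma borel_chart_at i : borel [set x : M | chart_at x = i].
Proof.
rewrite (_ : [set _ | _] = chart_dom (atlas i) `&` ~` \bigcup_(j in [set: 'I_(atlas_size M)])
    (if (j < i)%N then chart_dom (atlas j) else set0)).
  apply: borelI; first by apply: borel_open; exact: chart_dom_open.
  apply: borelC; apply: borel_bigcup_ord => j.
  case: ifP => _; last exact: sigma_algebra0.
  by apply: borel_open; exact: chart_dom_open.
apply/seteqP; split=> x.
  move=> /chart_atP[ix imin]; split=> // -[j _]; case: ifP => // ji jx.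
  by have := imin _ jx; rewrite leqNgt ji.
move=> [ix notj]; apply/chart_atP; split=> // j jx.
by rewrite leqNgt; apply/negP => ji; apply: notj; exists j; rewrite ?ji.
Qed.

Lemma borel_to_coord i (Z : set (n.-tuple (measurableTypeR R))) : measurable Z ->
  borel (chart_dom (atlas i) `&` (@tuple_of_row R n \o to_coord (atlas i)) @^-1` Z).
Proof.
set f := @tuple_of_row R n \o to_coord (atlas i); set D := chart_dom (atlas i).
have bD : borel D by apply: borel_open; exact: chart_dom_open.
suff : measurable `<=` [set Z | borel (D `&` f @^-1` Z)] by apply.
apply: smallest_sub.
  by apply: sigma_algebra_partial_preimage => //; exact: smallest_sigma_algebra.
move=> A; rewrite -bigcup_seq => -[j _ [Y mY <-]] /=.
have : measurable `<=` [set Y : set (measurableTypeR R) |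
    borel (D `&` (fun x => to_coord (atlas i) x 0 j) @^-1` Y)].
  rewrite (RGenOpens.measurableE R); apply: smallest_sub.
    by apply: sigma_algebra_partial_preimage => //; exact: smallest_sigma_algebra.
  move=> _ [a [b ->]] /=; apply: borel_open; apply: open_setI_preimage.
  - exact: chart_dom_open.
  - move=> x ix; exact: (@continuous_comp _ _ _ (to_coord (atlas i))
      (fun y : 'rV[R]_n => y 0 j) x (to_coord_cont ix) (@coord_continuous _ 1 n 0 j _)).
  - exact: interval_open.
move=> /(_ Y mY) /=; congr (borel (_ `&` _)).
apply/seteqP; split=> x /=; rewrite tnth_mktuple //.
by move=> [].
Qed.

End null_sets.

Section null_sets_in_charts.
Variables (R : realType) (n : nat) (M : closedManifold R n).
Implicit Types (i : 'I_(atlas_size M)) (s g : tensor_field M) (N B : set M).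
Notation leb := (lebesgue_tuple R n).

Lemma measurable_vol_density i g B : metrics g -> borel B ->
  measurable_fun (tuple_piece i) (fun t =>
    ((\1_B (chart_point i t))%:E * (Num.sqrt (\det (g (chart_point i t))))%:E)%E).
Proof.
move=> [gs gp] bB; have mi := measurable_tuple_piece i.
apply: emeasurable_funM; apply/measurable_EFinP; last first.
  have mc := measurable_class R (tuple_piece i); apply: (class_sqrt mc).
  by apply: (class_det mc) => j k; exact: measurable_piece_entry.
apply: (eq_measurable_fun
  (\1_(tuple_piece i `&` chart_point i @^-1` B) : _ -> R)).
  move=> t ti; rewrite !indicE; congr (_%:R).
  by rewrite in_setI ti.
by apply: measurable_indic; exact: measurable_chart_point.
Qed.

(** The density of the volume of a metric is positive, so its null sets are those
of the Lebesgue measure in the pieces. *)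
Lemma nullsetP g N : metrics g -> nullset g N <->
  forall i, leb.-negligible (tuple_piece i `&` chart_point i @^-1` N).
Proof.
move=> gm; have dens_ge0 i B t : (0 <= (\1_B (chart_point i t))%:E *
    (Num.sqrt (\det (g (chart_point i t))))%:E)%E.
  by rewrite -EFinM lee_fin mulr_ge0 ?sqrtr_ge0 // indicE.
split=> [[B [bB volB NB]] i|Nnull].
  have mi := measurable_tuple_piece i.
  move: volB; rewrite /vol vol_int_pieces => volB.
  have int0 : (\int[leb]_(t in tuple_piece i) `|(\1_B (chart_point i t))%:E *
      (Num.sqrt (\det (g (chart_point i t))))%:E| = 0)%E.
    under eq_integral do rewrite gee0_abs ?dens_ge0 //.
    have /eqP := volB; rewrite seq_psume_eq0; last by move=> j _; exact: integral_ge0.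
    by move=> /allP /(_ i (mem_index_enum i)) /eqP.
  have [Z [mZ Z0 nzZ]] := (ae_eq_integral_abs leb mi
    (measurable_vol_density (i := i) gm bB)).1 int0.
  exists Z; split=> // t [ti Nt]; apply: nzZ => /= /(_ ti) /eqP.
  rewrite indicE mem_set; last exact: NB.
  by rewrite mul1e eqe gt_eqF // sqrtr_gt0 metrics_det_gt0.
have [Z ZP] := choice Nnull.
pose B := \bigcup_i ([set x : M | chart_at x = i] `&` (chart_dom (atlas i) `&`
  (@tuple_of_row R n \o to_coord (atlas i)) @^-1` Z i)).
have bB : borel B.
  apply: borel_bigcup_ord => i; apply: borelI; first exact: borel_chart_at.
  by apply: borel_to_coord; have [] := ZP i.
exists B; split => //; last first.
  move=> x Nx; have dx := chart_dom_at x; exists (chart_at x) => //; split=> //.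
  split=> //=; have [_ _ ZN] := ZP (chart_at x); apply: ZN.
  have cx : chart_point (chart_at x)
      (tuple_of_row (to_coord (atlas (chart_at x)) x)) = x.
    by rewrite /chart_point tuple_of_rowK to_coordK.
  split; last by rewrite /= cx.
  split; first by rewrite /= tuple_of_rowK; exact: to_coord_img.
  by rewrite /= -[of_coord _ _]/(chart_point _ _) cx.
rewrite /vol vol_int_pieces big1 // => i _.
have [mZ Z0 ZN] := ZP i.
have mi := measurable_tuple_piece i.
transitivity (\int[leb]_(t in tuple_piece i) `|(\1_B (chart_point i t))%:E *
    (Num.sqrt (\det (g (chart_point i t))))%:E|)%E.
  by apply: eq_integral => t _; rewrite gee0_abs.
apply/(ae_eq_integral_abs leb mi (measurable_vol_density (i := i) gm bB)).
exists (Z i); split=> // t /= /not_implyP[ti]; rewrite indicE.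
case: (boolP (_ \in B)) => [/set_mem|_]; last by rewrite mul0e.
move=> [j _ [cj [_ /= Zj]]] _.
have ij : j = i by rewrite -cj; case: ti.
by move: Zj; rewrite ij /= of_coordK ?row_of_tupleK //; case: ti.
Qed.

End null_sets_in_charts.

(** * Curves of metrics at a point *)

Section curves.
Variables (R : realType) (n : nat) (M : closedManifold R n).
Implicit Types (i : 'I_(atlas_size M)) (c dc : R -> tensor_field M) (a b t : R).

(** Composing a curve on [a, b] with this retraction extends it to the whole line,
so that one-sided continuity at the end points becomes plain continuity. *)
Definition clip a b t : R := Num.max a (Num.min t b).

Lemma clip_in a b t : a <= b -> clip a b t \in `[a, b].
Proof.
by move=> ab; rewrite in_itv /= /clip le_max lexx ge_max ab ge_min lexx orbT.
Qed.

Lemma clip_id a b t : t \in `[a, b] -> clip a b t = t.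
Proof.
by rewrite in_itv /= => /andP[a_t tb]; rewrite /clip min_l // max_r.
Qed.

Lemma clip_continuous a b : continuous (clip a b).
Proof.
move=> t; apply: (@continuous_max _ _ (cst a) (fun t => Num.min t b) t).
  exact: cvg_cst.
by apply: (@continuous_min _ _ id (cst b) t); [exact: cvg_id|exact: cvg_cst].
Qed.

(** Frechet convergence on the compact set reduced to y. *)
Lemma frechet_cvg_entry (T : Type) (F : set_system T) {FF : Filter F}
    (h : T -> tensor_field M) (l : tensor_field M) i y j k :
  frechet_cvg F h l -> piece i y ->
  h u (of_coord (atlas i) y) j k @[u --> F] --> l (of_coord (atlas i) y) j k.
Proof.
move=> hl iy.
have hly : h u (of_coord (atlas i) y) @[u --> F] --> l (of_coord (atlas i) y).
  apply/cvgrPdist_lt => e e0.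
  have y_img : [set y] `<=` chart_img (atlas i) by move=> _ ->; case: iy.
  have := hl i [::] [set y] e (@compact_set1 _ y) y_img e0.
  apply: filterS => u /(_ y erefl) /=.
  by rewrite !components_piece // distrC.
have cjk := @coord_continuous R n n j k (l (of_coord (atlas i) y)).
exact: cvg_comp hly cjk.
Qed.

Section one_curve.
Variables (a b : R) (c dc : R -> tensor_field M).
Hypotheses (ab : a < b) (cdc : C1_curve a b c dc).
Variables (i : 'I_(atlas_size M)) (y : 'rV[R]_n) (iy : piece i y) (j k : 'I_n).
Let x := of_coord (atlas i) y.

Lemma velocity_cvg t : t \in `[a, b] ->
  dc u x j k @[u --> within [set u | u \in `[a, b]] (nbhs t)] --> dc t x j k.
Proof. by move=> tab; have [_ _ _ dct] := cdc tab; exact: frechet_cvg_entry. Qed.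

Lemma quotient_cvg t : t \in `[a, b] ->
  e^-1 * (c (t + e) x j k - c t x j k)
    @[e --> within [set e | t + e \in `[a, b]] 0^'] --> dc t x j k.
Proof.
move=> tab; have [_ _ ct _] := cdc tab.
have -> : (fun e => e^-1 * (c (t + e) x j k - c t x j k)) =
    (fun e => (e^-1 *: (c (t + e) x - c t x)) j k).
  by apply/funext => e; rewrite !mxE.
exact: frechet_cvg_entry ct iy.
Qed.

(** A curve is continuous because its difference quotients converge. *)
Lemma curve_cvg t : t \in `[a, b] ->
  c u x j k @[u --> within [set u | u \in `[a, b]] (nbhs t)] --> c t x j k.
Proof.
move=> tab; have qt := quotient_cvg tab.
set D := [set e | t + e \in `[a, b]] in qt.
have e0 : e @[e --> within D 0^'] --> (0 : R).
  by move=> B; rewrite /= => HB; apply: filterS HB => e Be _ _.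
have FD : Filter (within D 0^') by exact: within_filter.
have cvg0 : c t x j k + e * (e^-1 * (c (t + e) x j k - c t x j k))
    @[e --> within D 0^'] --> c t x j k.
  rewrite [X in _ --> X](_ : _ = c t x j k + 0 * dc t x j k).
    by apply: cvgD; [exact: cvg_cst|exact: cvgM e0 qt].
  by rewrite mul0r addr0.
move=> B Bct.
have : \forall e \near (0 : R), D e -> B (c (t + e) x j k).
  have := cvg0 B Bct; rewrite /within /= => H.
  near=> e => De; have [->|en0] := eqVneq e 0.
    by rewrite addr0; exact: nbhs_singleton.
  have : e != 0 -> D e -> B (c t x j k + e * (e^-1 * (c (t + e) x j k - c t x j k))).
    by near: e.
  by move=> /(_ en0 De); rewrite mulrA mulfV // mul1r addrC subrK.
rewrite (near_shift t) sub0r => near_t.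
rewrite /nbhs /= /within /=; apply: filterS near_t => u /=.
by rewrite /D /= addrC subrK.
Unshelve. all: by end_near. Qed.

Lemma clip_cvg t : clip a b u @[u --> t] -->
  within [set u | u \in `[a, b]] (nbhs (clip a b t)).
Proof.
move=> B HB.
have HB' : \forall u \near clip a b t, u \in `[a, b] -> B u by exact: HB.
have near_t : \forall u \near t, clip a b u \in `[a, b] -> B (clip a b u).
  exact: (clip_continuous (a := a) (b := b) (x := t) HB').
have : \forall u \near t, B (clip a b u); last by [].
by apply: filterS near_t => u; apply; apply: clip_in; exact: ltW.
Qed.

Lemma clipped_curve_continuous : continuous (fun t => c (clip a b t) x j k).
Proof.
move=> t; exact: (@cvg_comp _ _ _ (clip a b) (fun u => c u x j k) _ _ _
  (clip_cvg (t := t)) (curve_cvg (clip_in t (ltW ab)))).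
Qed.

Lemma clipped_velocity_continuous : continuous (fun t => dc (clip a b t) x j k).
Proof.
move=> t; exact: (@cvg_comp _ _ _ (clip a b) (fun u => dc u x j k) _ _ _
  (clip_cvg (t := t)) (velocity_cvg (clip_in t (ltW ab)))).
Qed.

Lemma is_derive_clipped_curve t : t \in `]a, b[ ->
  is_derive t 1 (fun u => c (clip a b u) x j k) (dc (clip a b t) x j k).
Proof.
move=> tab; have tab' : t \in `[a, b] by exact: subset_itv_oo_cc tab.
rewrite (clip_id tab').
have H : h^-1 *: (c (clip a b (h *: 1 + t)) x j k - c (clip a b t) x j k)
    @[h --> 0^'] --> dc t x j k.
  have qt := quotient_cvg tab'.
  move=> B /qt HB.
  have near_B : \forall h \near 0^', t + h \in `[a, b] ->
    B (h^-1 * (c (t + h) x j k - c t x j k)) by exact: HB.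
  have near_ab : \forall h \near (0 : R), t + h \in `]a, b[.
    have : \forall u \near t, u \in `]a, b[ by exact: near_in_itvoo.
    by rewrite (near_shift 0) subr0; apply: filterS => h /=; rewrite addrC.
  have near_ab' : \forall h \near 0^', t + h \in `]a, b[.
    by apply: filterS near_ab.
  have : \forall h \near 0^',
      B (h^-1 *: (c (clip a b (h *: 1 + t)) x j k - c (clip a b t) x j k)); last by [].
  apply: filterS2 near_ab' near_B => h /subset_itv_oo_cc tab_h /(_ tab_h).
  by rewrite (clip_id tab') [h *: 1]mulr1 (addrC h) (clip_id tab_h).
apply: DeriveDef; first by apply/cvg_ex; exists (dc t x j k).
exact: cvg_lim.
Qed.

End one_curve.

End curves.

(** * Probes along paths of metrics and the L2 distance *)

Section lower_integral.
Local Open Scope ereal_scope.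

(** The integral of a nonnegative function is a supremum over simple functions
below it, so it is monotone without any measurability of the larger one. *)
Lemma ge0_le_lower_integral (R : realType) d (T : measurableType d)
    (mu : {measure set T -> \bar R}) (D : set T) (f1 f2 : T -> \bar R) :
  (forall x, D x -> 0 <= f1 x) -> (forall x, D x -> f1 x <= f2 x) ->
  \int[mu]_(x in D) f1 x <= \int[mu]_(x in D) f2 x.
Proof.
move=> f10 f12.
have f20 x : D x -> 0 <= f2 x by move=> Dx; rewrite (le_trans (f10 x Dx)) ?f12.
rewrite !ge0_integralE //; apply: le_ereal_sup => _ [h /= hf1 <-].
exists h => //= x; apply: le_trans (hf1 x) _.
by apply: lee_restrict.
Qed.

(** Cauchy-Schwarz for f and the indicator function of its support. *)
Lemma integral_le_sqrt (R : realType) d (T : measurableType d)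
    (mu : {measure set T -> \bar R}) (Y : set T) (f : T -> R) :
  measurable Y -> measurable_fun setT f -> (forall x, (0 <= f x)%R) ->
  (forall x, ~ Y x -> f x = 0%R) ->
  \int[mu]_x (f x)%:E <=
    mu Y `^ 2^-1 * (\int[mu]_(x in Y) (f x ^+ 2)%:E) `^ 2^-1.
Proof.
move=> mY mf f0 fY.
have m1 : measurable_fun setT (\1_Y : T -> R) by exact: measurable_indic.
have half2 : (2^-1 + 2^-1 = 1 :> R)%R by field.
have := hoelder mu m1 mf (ltr0n R 2) (ltr0n R 2) half2.
rewrite Lnorm1 unlock /=.
have -> : \int[mu]_x `|(\1_Y \* f)%R x|%:E = \int[mu]_x (f x)%:E.
  apply: eq_integral => x _ /=; rewrite indicE.
  case: (boolP (x \in Y)) => xY; rewrite ?mul1r ?mul0r ?ger0_norm //.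
  by rewrite fY // => Yx; rewrite mem_set in xY.
have -> : \int[mu]_x (`|(\1_Y x)%:E| `^ 2) = mu Y.
  rewrite -(setIT Y) -integral_indic //; apply: eq_integral => x _.
  rewrite setIT indicE; case: (x \in Y) => /=.
    by rewrite normr1 powR1.
  by rewrite normr0 powR0.
have -> // : \int[mu]_x (`|(f x)%:E| `^ 2) = \int[mu]_(x in Y) (f x ^+ 2)%:E.
rewrite [RHS]integral_mkcond; apply: eq_integral => x _.
rewrite patchE; case: ifPn => xY.
  by rewrite /= ger0_norm // -powR_mulrn.
rewrite fY; last by move=> Yx; rewrite mem_set in xY.
by rewrite /= normr0 powR0.
Qed.

End lower_integral.

Section segments.
Variables (R : realType) (n : nat) (M : closedManifold R n).
Implicit Types (i : 'I_(atlas_size M)) (c dc : R -> tensor_field M) (a b : R).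
Notation leb := (lebesgue_tuple R n).

Lemma speed0 (A : 'M[R]_n) : speed A 0 = 0.
Proof. by rewrite /speed /speed2 /tensor_inner mulmx0 mxtrace0 mul0r sqrtr0. Qed.

Lemma posdef1 : posdef (1%:M : 'M[R]_n).
Proof.
move=> v; apply: contraNT; rewrite -leNgt /bilin mulmx1 mxE => v_le0.
apply/eqP/rowP => j; rewrite mxE; apply/eqP; rewrite -sqrf_eq0 expr2.
have sq_ge0 k : 0 <= v 0 k * v^T k 0 by rewrite mxE -expr2 sqr_ge0.
have /eqP : \sum_k v 0 k * v^T k 0 = 0.
  by apply/eqP; rewrite eq_le v_le0 sumr_ge0.
by rewrite psumr_eq0 // => /allP /(_ j (mem_index_enum j)); rewrite mxE.
Qed.

Lemma speed2_ge0 (A h : 'M[R]_n) : A^T = A -> posdef A -> h^T = h ->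
  0 <= speed2 A h.
Proof. by move=> As Ap hs; rewrite mulr_ge0 ?sqrtr_ge0 // tensor_inner_ge0. Qed.

Lemma measurable_piece_speed2 i (g h : tensor_field M) : metrics g ->
  smooth_sym h -> measurable_fun (tuple_piece i)
    (fun t => (speed2 (g (chart_point i t)) (h (chart_point i t)))%:E).
Proof.
move=> [gs gp] hs; apply/measurable_EFinP.
have mg j k := @measurable_piece_entry R n M i _ j k gs.
have mh j k := @measurable_piece_entry R n M i _ j k hs.
have mc := measurable_class R (tuple_piece i).
have gu t : g (chart_point i t) \in unitmx by exact: posdef_unit.
have miA := class_invmx mc gu mg.
apply: (class_mul mc); last by apply: (class_sqrt mc); exact: class_det.
apply: (class_sum mc) => j.
exact: (class_mulmx mc (class_mulmx mc (class_mulmx mc miA mh) miA) mh).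
Qed.

Lemma piece_le_l2_inner i (g h : tensor_field M) : metrics g -> smooth_sym h ->
  (\int[leb]_(t in tuple_piece i)
    (speed2 (g (chart_point i t)) (h (chart_point i t)))%:E <= l2_inner g h h)%E.
Proof.
move=> gm hs; rewrite /l2_inner vol_int_pieces (bigD1 i) //=.
rewrite leeDl // sume_ge0 // => j _; apply: integral_ge0 => t _.
rewrite -EFinM lee_fin; have [[gs _] gp] := gm; have [hsym _] := hs.
exact: speed2_ge0.
Qed.

(** The function m is the integral over Y of the pointwise speeds. It stands in for
the L2 norm of the velocity, whose measurability in t is thus never in question,
and Cauchy-Schwarz bounds it by that norm. *)
Lemma segment_estimate c dc a b i Y (v : 'rV[R]_n) (k : R) : a < b ->
  C1_curve a b c dc -> (forall t, t \in `[a, b] -> metrics (c t)) ->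
  measurable Y -> Y `<=` tuple_piece i -> (leb Y `^ 2^-1 <= k%:E)%E ->
  exists m : measurableTypeR R -> \bar R, [/\ measurable_fun setT m,
    forall t, (0 <= m t)%E,
    forall t, t \in `[a, b] -> (m t <= k%:E * l2_norm (c t) (dc t))%E &
    (\int[leb]_(x in Y) `|probe v (c b (chart_point i x)) -
        probe v (c a (chart_point i x))|%:E <=
      n.+2%:R%:E * \int[@lebesgue_measure R]_(t in `[a, b]) m t)%E].
Proof.
move=> ab cdc cm mY Yi Yk.
have cin t := clip_in t (ltW ab).
(* Outside Y the family is constant, so that its increments and speeds vanish
   there and the integrals may range over the whole space. *)
pose A t x := if x \in Y then c (clip a b t) (chart_point i x) else 1%:M.
pose A' t x := if x \in Y then dc (clip a b t) (chart_point i x) else 0.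
have piece_x x : x \in Y -> piece i (row_of_tuple x) by move/set_mem/Yi.
have dcs t : smooth_sym (dc (clip a b t)) by have [] := cdc _ (cin t).
have As t x : (A t x)^T = A t x.
  rewrite /A; case: ifP => _; last exact: trmx1.
  by have [[]] := cm _ (cin t).
have Ap t x : posdef (A t x).
  rewrite /A; case: ifP => _; last exact: posdef1.
  by have [] := cm _ (cin t).
have A's t x : (A' t x)^T = A' t x.
  by rewrite /A'; case: ifP => _; [have [] := dcs t|exact: trmx0].
have mif (s : tensor_field M) (B : 'M[R]_n) j l : smooth_sym s ->
    measurable_fun setT (fun x => (if x \in Y then s (chart_point i x) else B) j l).
  move=> ss.
  rewrite (_ : (fun x => _) = fun x => if x \in Y then s (chart_point i x) j l else B j l).
    apply: measurable_fun_if => //.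
    + apply: (measurable_fun_bool true); rewrite setTI.
      rewrite (_ : _ @^-1` _ = Y) //.
      by apply/seteqP; split=> x /=; [move/set_mem|move/mem_set].
    + rewrite setTI (_ : _ @^-1` _ = Y).
        apply: (measurable_funS (measurable_tuple_piece i) Yi).
        exact: measurable_piece_entry.
      by apply/seteqP; split=> x /=; [move/set_mem|move/mem_set].
  by apply/funext => x; case: ifP.
have mA t : class_mx [set f | measurable_fun setT f] (A t).
  by move=> j l; apply: mif; have [] := cm _ (cin t).
have mA' t : class_mx [set f | measurable_fun setT f] (A' t).
  by move=> j l; exact: mif.
have cA x : class_mx [set f : R -> R | continuous f] (A^~ x).
  move=> j l /=; rewrite /A; case: (boolP (x \in Y)) => [/piece_x xi|_].
    exact: (clipped_curve_continuous ab cdc xi).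
  exact: cst_continuous.
have cA' x : class_mx [set f : R -> R | continuous f] (A'^~ x).
  move=> j l /=; rewrite /A'; case: (boolP (x \in Y)) => [/piece_x xi|_].
    exact: (clipped_velocity_continuous ab cdc xi).
  exact: cst_continuous.
have dA x t j l : t \in `]a, b[ ->
    is_derive t 1 (fun u => A u x j l) (A' t x j l).
  move=> tab; rewrite /A /A'; case: (boolP (x \in Y)) => [/piece_x xi|_].
    exact: (is_derive_clipped_curve cdc xi).
  by rewrite [X in is_derive _ _ _ X]mxE; exact: is_derive_cst.
have [mS Sle] := integral_probe_le (@lebn R n) v ab As Ap A's mA mA' cA cA' dA.
exists (fun t => \int[@lebn R n]_x (speed (A t x) (A' t x))%:E)%E; split=> //.
- by move=> t; apply: integral_ge0 => x _; rewrite lee_fin sqrtr_ge0.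
- move=> t tab.
  have [ctm dct] : metrics (c t) /\ smooth_sym (dc t).
    by split; [exact: cm|have [] := cdc t tab].
  have [[cts _] ctp] := ctm; have [dctsym _] := dct.
  have mf : measurable_fun setT (fun x => speed (A t x) (A' t x)).
    apply: (class_speed (measurable_class R setT)) => // x.
    exact: posdef_unit.
  apply: le_trans (integral_le_sqrt (@lebn R n) mY mf _ _) _.
  + by move=> x; rewrite sqrtr_ge0.
  + by move=> x nYx; rewrite /A' memNset // speed0.
  apply: lee_pmul => //; rewrite ?poweR_ge0 //.
  apply: gt0_ler_poweR => //; rewrite ?in_itv /= ?leey ?andbT.
  + by apply: integral_ge0 => x _; rewrite lee_fin sqr_ge0.
  + apply: le_trans (piece_le_l2_inner i ctm dct).
    by apply: integral_ge0 => x _; rewrite lee_fin speed2_ge0.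
  apply: le_trans (piece_le_l2_inner i ctm dct).
  rewrite (eq_integral (fun x =>
    (speed2 (c t (chart_point i x)) (dc t (chart_point i x)))%:E)).
    apply: ge0_subset_integral => //; first exact: measurable_tuple_piece.
      exact: measurable_piece_speed2.
    by move=> x _; rewrite lee_fin speed2_ge0.
  move=> x xY; rewrite /A /A' xY clip_id // sqr_sqrtr //.
  exact: speed2_ge0.
apply: le_trans Sle.
rewrite [leLHS]integral_mkcond le_eqVlt; apply/orP; left; apply/eqP.
apply: eq_integral => x _; rewrite patchE /A.
have aab : a \in `[a, b] by rewrite in_itv /= lexx ltW.
have bab : b \in `[a, b] by rewrite in_itv /= lexx ltW.
by case: ifP => _; rewrite ?(clip_id aab) ?(clip_id bab) // subrr normr0.
Qed.

End segments.

Section distance.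
Variables (R : realType) (n : nat) (M : closedManifold R n).
Implicit Types (i : 'I_(atlas_size M)) (c : R -> tensor_field M) (g : tensor_field M).
Notation leb := (lebesgue_tuple R n).
Notation mu := (@lebesgue_measure R).

Lemma measurable_piece_probe i g (v : 'rV[R]_n) : metrics g ->
  measurable_fun (tuple_piece i) (fun x => probe v (g (chart_point i x))).
Proof.
move=> [gs gp]; apply: (class_probe (measurable_class R (tuple_piece i))) => //.
by move=> j k; exact: measurable_piece_entry.
Qed.

Lemma path_lt_last (a : R) (s : seq R) : path <%R a s -> a <= last a s.
Proof.
elim: s a => [//|b s IH] a /= /andP[/ltW ab /IH]; exact: le_trans.
Qed.

Section one_piece.
Variables (i : 'I_(atlas_size M)) (Y : set (n.-tuple (measurableTypeR R))).
Hypotheses (mY : measurable Y) (Yi : Y `<=` tuple_piece i).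
Variables (v : 'rV[R]_n) (k : R).
Hypothesis Yk : (leb Y `^ 2^-1 <= k%:E)%E.

Definition probe_increment (g0 g1 : tensor_field M) : \bar R :=
  (\int[leb]_(x in Y) `|probe v (g1 (chart_point i x)) -
        probe v (g0 (chart_point i x))|%:E)%E.

Lemma measurable_probe_increment g0 g1 : metrics g0 -> metrics g1 ->
  measurable_fun Y (fun x => `|probe v (g1 (chart_point i x)) -
        probe v (g0 (chart_point i x))|%:E).
Proof.
move=> g0m g1m; apply/measurable_EFinP; apply: measurableT_comp => //.
apply: (measurable_funS (measurable_tuple_piece i) Yi).
by apply: measurable_funB; exact: measurable_piece_probe.
Qed.

Lemma probe_increment_triangle g0 g1 g2 : metrics g0 -> metrics g1 -> metrics g2 ->
  (probe_increment g0 g2 <= probe_increment g0 g1 + probe_increment g1 g2)%E.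
Proof.
move=> m0 m1 m2; rewrite /probe_increment -ge0_integralD //; last 2 first.
- exact: measurable_probe_increment.
- exact: measurable_probe_increment.
apply: ge0_le_lower_integral => x Yx; first by rewrite lee_fin.
rewrite -EFinD lee_fin.
move: (probe v (g0 _)) (probe v (g1 _)) (probe v (g2 _)) => p0 p1 p2.
have -> : p2 - p0 = (p1 - p0) + (p2 - p1) by ring.
exact: ler_normD.
Qed.

(** The estimates of the segments add up. At the breakpoints the given velocity c'
is arbitrary and m is set to 0. *)
Lemma path_estimate (c c' : R -> tensor_field M) (s : seq R) (a : R) :
  path <%R a s -> (forall t, t \in `[a, last a s] -> metrics (c t)) ->
  (forall k, (k < size s)%N ->
    exists2 dc, C1_curve (nth 0 (a :: s) k) (nth 0 s k) c dc &
      forall t, t \in `]nth 0 (a :: s) k, nth 0 s k[ -> c' t = dc t) ->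
  exists m : measurableTypeR R -> \bar R, [/\ measurable_fun setT m,
    forall t, (0 <= m t)%E,
    forall t, t \in `[a, last a s] -> (m t <= k%:E * l2_norm (c t) (c' t))%E &
    (probe_increment (c a) (c (last a s)) <=
      n.+2%:R%:E * \int[mu]_(t in `[a, last a s]) m t)%E].
Proof.
have k0 : (0 <= k%:E)%E by rewrite (le_trans _ Yk) // poweR_ge0.
elim: s a => [|b s IH] a /=.
  move=> _ _ _; exists (fun=> 0%E); split=> // [t _|].
    by rewrite mule_ge0 // poweR_ge0.
  rewrite integral0 mule0 /probe_increment integral0_eq // => x _.
  by rewrite subrr normr0.
move=> /andP[ab sb] cm cs; set e := last b s.
have be : b <= e by exact: path_lt_last.
have aab : `[a, b] `<=` `[a, e] by apply: subset_itvl; rewrite bnd_simp.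
have bbe : `[b, e] `<=` `[a, e] by apply: subset_itvr; rewrite bnd_simp ltW.
have [dc cdc c'dc] := cs 0 (ltn0Sn _).
have [m1 [mm1 m10 m1le m1int]] := segment_estimate v ab cdc
  (fun t tab => cm t (aab t tab)) mY Yi Yk.
have [m2 [mm2 m20 m2le m2int]] := IH b sb (fun t tbe => cm t (bbe t tbe))
  (fun l ls => cs l.+1 ls).
have msub (m : measurableTypeR R -> \bar R) (D : set (measurableTypeR R)) :
    measurable D -> measurable_fun setT m -> measurable_fun setT (m \_ D).
  by move=> mD mm; apply/(measurable_restrictT _ _).1 => //; exact: measurable_funTS.
have m1ab : measurable (`]a, b[%classic : set (measurableTypeR R)).
  exact: measurable_itv.
have m2be : measurable (`]b, e]%classic : set (measurableTypeR R)).
  exact: measurable_itv.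
pose h1 := m1 \_ (`]a, b[%classic : set (measurableTypeR R)).
pose h2 := m2 \_ (`]b, e]%classic : set (measurableTypeR R)).
have h10 t : (0 <= h1 t)%E by exact: erestrict_ge0.
have h20 t : (0 <= h2 t)%E by exact: erestrict_ge0.
exists (fun t => h1 t + h2 t)%E; split=> [|t|t tae|].
- by apply: emeasurable_funD; exact: msub.
- exact: adde_ge0.
- rewrite /h1 /h2 !patchE; case: ifPn => [/set_mem /= tab|_].
    rewrite memNset ?adde0; last first.
      by rewrite /= !in_itv /= in tab *; case/andP: tab => _ /ltW; rewrite leNgt => /negbTE ->.
    rewrite c'dc //; apply: m1le; exact: subset_itv_oo_cc.
  rewrite add0e; case: ifPn => [/set_mem /= tbe|_].
    by apply: m2le; exact: subset_itv_oc_cc.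
  by rewrite mule_ge0 // poweR_ge0.
have -> : (\int[mu]_(t in `[a, e]) (h1 t + h2 t) =
    \int[mu]_(t in `[a, b]) m1 t + \int[mu]_(t in `[b, e]) m2 t)%E.
  rewrite ge0_integralD //=; last 2 first.
  - by apply: measurable_funTS; exact: msub.
  - by apply: measurable_funTS; exact: msub.
  congr (_ + _)%E; rewrite /h1 /h2 -integral_mkcondr setIidr.
  - by rewrite -(@integral_itv_bndoo _ a b m1 true false) //; exact: measurable_funTS.
  - by apply: subset_trans aab; exact: subset_itv_oo_cc.
  - by rewrite -integral_itv_obnd_cbnd //; exact: measurable_funTS.
  - by apply: subset_trans bbe; exact: subset_itv_oc_cc.
have cma : metrics (c a) by apply: cm; rewrite in_itv /= lexx (le_trans (ltW ab)).
have cmb : metrics (c b) by apply: cm; rewrite in_itv /= ltW.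
have cme : metrics (c e) by apply: cm; rewrite in_itv /= lexx (le_trans (ltW ab)).
apply: le_trans (probe_increment_triangle cma cmb cme) _.
rewrite ge0_muleDr ?integral_ge0 //; exact: leeD.
Qed.

(** The left-hand side does not depend on the path, so the infimum over all paths
may be taken. The 1 added to k makes the constant invertible. *)
Lemma probe_increment_le_dist g0 g1 :
  (probe_increment g0 g1 <= (n.+2%:R * (k + 1))%:E * l2_dist g0 g1)%E.
Proof.
have k0 : 0 <= k by rewrite -lee_fin (le_trans _ Yk) // poweR_ge0.
have C0 : 0 < n.+2%:R * (k + 1) by rewrite mulr_gt0 // ltr_wpDl.
rewrite -lee_pdivrMl //; apply: le_ereal_inf_tmp => _ [c [c' [cpath ->]]].
have [c0 c1 cm [s [s0 s1 cs]]] := cpath.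
rewrite lee_pdivrMl // /path_length.
rewrite -s1 in cm.
have [m [mm m0 mle]] := path_estimate s0 cm cs.
rewrite s1 in cm mle *; rewrite c0 c1 => /le_trans; apply.
rewrite EFinM -muleA lee_pmul2l ?lte_fin //.
rewrite -lee_pdivrMl ?ltr_wpDl // -ge0_integralZl //=; last 2 first.
- exact: measurable_funTS.
- by rewrite lee_fin invr_ge0 addr_ge0.
apply: ge0_le_lower_integral => t tab.
  by rewrite mule_ge0 // lee_fin invr_ge0 addr_ge0.
rewrite lee_pdivrMl ?ltr_wpDl //; apply: le_trans (mle _ tab) _.
by rewrite lee_wpmul2r ?poweR_ge0 // lee_fin lerDl.
Qed.

End one_piece.

End distance.

(** * Convergence of probes *)

Section real_sequences.
Variable R : realType.

Lemma cvgn_of_finite_variation (u : nat -> R) :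
  (\sum_(0 <= k <oo) `|u k.+1 - u k|%:E < +oo)%E -> cvgn u.
Proof.
move=> uoo; pose a k := u k.+1 - u k.
have abs_ge0 k : (0 <= `|a k|%:E)%E by rewrite lee_fin.
have sum_ge0 : (0 <= \sum_(0 <= k <oo) `|a k|%:E)%E by exact: nneseries_ge0.
have a_cvg : cvgn (series a).
  apply: normed_cvg; apply: nondecreasing_is_cvgn.
    by apply: nondecreasing_series => k _ _; exact: normr_ge0.
  exists (fine (\sum_(0 <= k <oo) `|a k|%:E)%E) => _ [m _ <-].
  rewrite -lee_fin fineK ?ge0_fin_numE // /series /= -sumEFin.
  apply: nneseries_lim_ge => k _ _; exact: abs_ge0.
have -> : u = (fun=> u 0) \+ series a.
  by apply/funext => m /=; rewrite /series /= telescope_sumr // addrC subrK.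
by apply: is_cvgD => //; exact: is_cvg_cst.
Qed.

Lemma lim_eq_of_liminf (u w : nat -> R) (a b : R) :
  u k @[k --> \oo] --> a -> w k @[k --> \oo] --> b ->
  limn_einf (fun k => `|w k - u k|%:E) = 0%E -> a = b.
Proof.
move=> ua wb.
have cvg_e : `|w k - u k|%:E @[k --> \oo] --> `|b - a|%:E.
  by apply: cvg_EFin; [exact: nearW|apply: cvg_norm; exact: cvgB].
have [-> _] := cvg_limn_einf_sup cvg_e.
by move=> [] /eqP; rewrite normr_eq0 subr_eq0 => /eqP.
Qed.

End real_sequences.

Section probe_limits.
Variables (R : realType) (n : nat).

Lemma bilin0 (A : 'M[R]_n) : bilin A 0 0 = 0.
Proof. by rewrite /bilin !mul0mx mxE. Qed.

Lemma posdef_bilin_ge0 (A : 'M[R]_n) v : posdef A -> 0 <= bilin A v v.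
Proof.
by move=> Ap; have [->|v0] := eqVneq v 0; [rewrite bilin0|rewrite ltW // Ap].
Qed.

Lemma probe0 (A : 'M[R]_n) : probe 0 A = fourth_root (\det A).
Proof. by rewrite /probe bilin0 addr0 divr1. Qed.

Lemma fourth_root_gt0 (x : R) : (0 < fourth_root x) = (0 < x).
Proof. by rewrite !sqrtr_gt0. Qed.

Lemma fourth_rootK (x : R) : 0 <= x -> fourth_root x ^+ 4 = x.
Proof. by move=> x0; rewrite -[4%N]/(2 * 2)%N exprM !sqr_sqrtr // sqrtr_ge0. Qed.

Lemma probe_continuous (v : 'rV[R]_n) (A : 'M[R]_n) : posdef A ->
  {for A, continuous (probe v)}.
Proof.
move=> Ap.
have cid : class_mx [set f : 'M[R]_n -> R | continuous f] id.
  by move=> i j; exact: coord_continuous.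
have cc := continuous_class R 'M[R]_n.
have cdet := class_sqrt cc (class_sqrt cc (class_det cc cid)).
have cbil := class_add cc (class_cst cc 1) (class_bilin cc v cid).
have nz : 1 + bilin A v v != 0.
  by rewrite gt_eqF // ltr_wpDr // posdef_bilin_ge0.
exact: (cvgM (cdet A) (cvgV nz (cbil A))).
Qed.

(** By polarisation: the probe at 0 gives the determinant, and then the probe at the
sum of two basis vectors gives the quadratic form there. *)
Lemma probe_inj (A B : 'M[R]_n) : A^T = A -> B^T = B -> posdef A -> posdef B ->
  probe 0 A = probe 0 B ->
  (forall i j, probe (delta_mx 0 i + delta_mx 0 j) A =
    probe (delta_mx 0 i + delta_mx 0 j) B) -> A = B.
Proof.
move=> As Bs Ap Bp; rewrite !probe0 => detE probeE.
have bilE i j : bilin A (delta_mx 0 i + delta_mx 0 j) (delta_mx 0 i + delta_mx 0 j)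
    = bilin B (delta_mx 0 i + delta_mx 0 j) (delta_mx 0 i + delta_mx 0 j).
  have := probeE i j; rewrite /probe detE.
  have rB : fourth_root (\det B) != 0.
    by rewrite gt_eqF // fourth_root_gt0 posdef_det_gt0.
  by move=> /(mulfI rB) /invr_inj /addrI.
have bilin_delta (C : 'M[R]_n) i j : C^T = C ->
    bilin C (delta_mx 0 i + delta_mx 0 j) (delta_mx 0 i + delta_mx 0 j)
    = C i i + C j j + 2 * C i j.
  move=> Cs; rewrite /bilin linearD /= !trmx_delta mulmxDl mulmxDr !mulmxDl.
  rewrite -!rowE -!colE !mxE.
  have -> : C j i = C i j by rewrite -{1}Cs mxE.
  by ring.
have diagE i : A i i = B i i.
  by have := bilE i i; rewrite !bilin_delta //; lra.
apply/matrixP => i j; have := bilE i j; rewrite !bilin_delta // !diagE; lra.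
Qed.

End probe_limits.

Section almost_everywhere_limits.
Variables (R : realType) (n : nat) (M : closedManifold R n).
Implicit Types (i : 'I_(atlas_size M)) (g : tensor_field M)
  (gk : nat -> tensor_field M).
Notation leb := (lebesgue_tuple R n).

(** Null sets may be looked for on sets of finite measure, where the L1 estimates
hold. *)
Lemma ae_piece i (Q : set (n.-tuple (measurableTypeR R))) :
  (forall Y, measurable Y -> Y `<=` tuple_piece i -> (leb Y < +oo)%E ->
    {ae leb, forall x, Y x -> Q x}) ->
  {ae leb, forall x, tuple_piece i x -> Q x}.
Proof.
move=> QY; have [F FT Ffin] := @sigma_finite_lebesgue_tuple R n.
have mi := measurable_tuple_piece i.
have neg k : leb.-negligible (~` [set x | (tuple_piece i `&` F k) x -> Q x]).
  have [mF Fk] := Ffin k; apply: QY; [exact: measurableI|by move=> x []|].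
  by apply: le_lt_trans Fk; apply: le_measure; rewrite ?inE //; exact: measurableI.
apply: negligibleS (negligible_bigcup neg) => x /= /not_implyP[ix nQ].
have : [set: n.-tuple (measurableTypeR R)] x by [].
by rewrite FT => -[k _ Fx]; exists k => //=; apply/not_implyP.
Qed.

Lemma l2_dist_ge0 (g0 g1 : tensor_field M) : (0 <= l2_dist g0 g1)%E.
Proof.
apply: le_ereal_inf_tmp => _ [c [c' [_ ->]]]; apply: integral_ge0 => t _.
exact: poweR_ge0.
Qed.

Section finite_part.
Variables (i : 'I_(atlas_size M)) (Y : set (n.-tuple (measurableTypeR R))).
Hypotheses (mY : measurable Y) (Yi : Y `<=` tuple_piece i).
Hypothesis Yfin : (leb Y < +oo)%E.

Lemma probe_increment_lipschitz (v : 'rV[R]_n) : exists2 C : R, 0 <= C &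
  forall g0 g1, (probe_increment i Y v g0 g1 <= C%:E * l2_dist g0 g1)%E.
Proof.
have Y12 : (leb Y `^ 2^-1)%E \is a fin_num.
  by apply: fin_num_poweR; rewrite ge0_fin_numE.
have Yk : (leb Y `^ 2^-1 <= (fine (leb Y `^ 2^-1))%:E)%E by rewrite fineK.
exists (n.+2%:R * (fine (leb Y `^ 2^-1) + 1)).
  by rewrite mulr_ge0 // addr_ge0 // fine_ge0 // poweR_ge0.
by move=> g0 g1; exact: probe_increment_le_dist.
Qed.

(** The increments of the probe have summable L1 norms, so that almost everywhere
they are summable themselves. *)
Lemma ae_probe_cvg gk : (forall k, metrics (gk k)) ->
  (\sum_(0 <= k <oo) l2_dist (gk k) (gk k.+1) < +oo)%E ->
  {ae leb, forall x, Y x -> cvgn (fun k => probe 0 (gk k (chart_point i x)))}.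
Proof.
move=> gkm sum_oo; have [C C0 Cle] := probe_increment_lipschitz 0.
pose f k x := `|probe 0 (gk k.+1 (chart_point i x)) -
  probe 0 (gk k (chart_point i x))|%:E.
have mf k : measurable_fun Y (f k) by exact: measurable_probe_increment.
have f0 k x : Y x -> (0 <= f k x)%E by rewrite lee_fin.
have msum : measurable_fun Y (fun x => \sum_(0 <= k <oo) f k x)%E.
  by apply: ge0_emeasurable_sum => // k x Yx _; exact: f0.
have int_fin : leb.-integrable Y (fun x => \sum_(0 <= k <oo) f k x)%E.
  apply/integrableP; split=> //.
  under eq_integral => x /set_mem Yx.
    rewrite gee0_abs; last by apply: nneseries_ge0 => k _ _; exact: f0.
    over.
  rewrite integral_nneseries //.
  apply: (@le_lt_trans _ _ (\sum_(0 <= k <oo) (C%:E * l2_dist (gk k) (gk k.+1)))%E).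
    apply: lee_nneseries => [k _ _|k _]; last exact: Cle.
    by apply: integral_ge0 => x; exact: f0.
  rewrite nneseriesZl; last by move=> k _; exact: l2_dist_ge0.
  by rewrite lte_mul_pinfty.
have := integrable_ae mY int_fin; apply: filterS => x fin_x Yx.
apply: cvgn_of_finite_variation.
by have := fin_x Yx; rewrite fin_numE => /andP[_]; rewrite ltey.
Qed.

(** By Fatou's lemma, convergence to 0 in L1 makes the lower limit vanish almost
everywhere, which replaces the extraction of a subsequence. *)
Lemma ae_probe_liminf gk0 gk1 (v : 'rV[R]_n) : (forall k, metrics (gk0 k)) ->
  (forall k, metrics (gk1 k)) ->
  l2_dist (gk0 k) (gk1 k) @[k --> \oo] --> 0%E ->
  {ae leb, forall x, Y x -> limn_einf (fun k =>
    `|probe v (gk1 k (chart_point i x)) - probe v (gk0 k (chart_point i x))|%:E)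
    = 0%E}.
Proof.
move=> m0 m1 dist0; have [C C0 Cle] := probe_increment_lipschitz v.
pose f k x := `|probe v (gk1 k (chart_point i x)) -
  probe v (gk0 k (chart_point i x))|%:E.
have mf k : measurable_fun Y (f k) by exact: measurable_probe_increment.
have f0 k x : Y x -> (0 <= f k x)%E by rewrite lee_fin.
have mlim : measurable_fun Y (fun x => limn_einf (f^~ x)).
  rewrite (_ : (fun x => _) = fun x => (- limn_esup (fun k => - f k x))%E).
    apply: measurableT_comp => //; apply: measurable_fun_limn_esup => k.
    exact: measurableT_comp.
  by apply/funext => x; rewrite (limn_esupN (f^~ x)) oppeK.
have lim0 x : Y x -> (0 <= limn_einf (f^~ x))%E.
  move=> Yx; rewrite limn_einf_lim; apply: lime_ge; first exact: is_cvg_einfs.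
  by apply: nearW => N; apply: le_ereal_inf_tmp => _ [k _ <-]; exact: f0.
have int0 : (\int[leb]_(x in Y) f k x)%E @[k --> \oo] --> 0%E.
  apply: (@squeeze_cvge _ _ _ _ (cst 0%E) _
    (fun k => C%:E * l2_dist (gk0 k) (gk1 k))%E).
  - apply: nearW => k; rewrite integral_ge0 //=; last exact: f0.
    exact: Cle.
  - exact: cvg_cst.
  - by rewrite -(mule0 C%:E); exact: cvgeZl.
have : (\int[leb]_(x in Y) limn_einf (f^~ x) = 0)%E.
  apply/eqP; rewrite eq_le integral_ge0 // andbT.
  apply: le_trans (fatou leb mY mf f0) _.
  by have [-> _] := cvg_limn_einf_sup int0.
move=> lim_int.
have : (\int[leb]_(x in Y) `|limn_einf (f^~ x)| = 0)%E.
  rewrite -[RHS]lim_int; apply: eq_integral => x /set_mem Yx.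
  by rewrite gee0_abs // lim0.
by move=> /(ae_eq_integral_abs leb mY mlim).1.
Qed.

End finite_part.

(** The deflated set only asks for small determinants at some indices. As all the
determinants are positive, such indices are arbitrarily large, so a convergent
sequence of probes then tends to 0. *)
Lemma deflated_seqP g gk p a : metrics g -> (forall k, metrics (gk k)) ->
  probe 0 (gk k p) @[k --> \oo] --> a -> deflated_seq g gk p <-> a = 0.
Proof.
move=> gm gkm; under eq_fun do rewrite probe0; set u := fun k => _ => ua.
have dg := metrics_det_gt0 p gm.
have dk k := metrics_det_gt0 p (gkm k).
have detE k : \det (invmx (g p) *m gk k p) = u k ^+ 4 / \det (g p).
  by rewrite det_mulmx det_inv mulrC /u fourth_rootK // ltW.
have u0 k : 0 < u k by rewrite /u fourth_root_gt0.
split=> [Dp|a0 e e0].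
  have infinitely N e : 0 < e -> exists2 k, (N <= k)%N & u k < e.
    elim: N e => [|N IH] e e0.
      have [|k] := Dp (e ^+ 4 / \det (g p)); first by rewrite divr_gt0 // exprn_gt0.
      rewrite detE ltr_pM2r ?invr_gt0 // ltr_pXn2r ?nnegrE ?ltW // => ue.
      by exists k.
    have [|k Nk] := IH (Num.min e (u N)); first by rewrite lt_min e0 u0.
    rewrite lt_min => /andP[ue uN]; exists k => //.
    by rewrite ltn_neqAle Nk andbT; apply: contraTneq uN => ->; rewrite ltxx.
  have a_ge0 : 0 <= a by apply: (cvgr_to_ge ua); apply: nearW => k; rewrite ltW.
  apply/eqP; rewrite eq_le a_ge0 andbT leNgt; apply/negP => a_gt0.
  have a2 : 0 < a / 2 by rewrite divr_gt0.
  have [N _ HN] : \forall k \near \oo, `|a - u k| < a / 2.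
    by move/cvgrPdist_lt : ua; apply.
  have [k Nk uk] := infinitely N _ a2.
  have := HN k Nk; rewrite /= ltr_norml => /andP[_ ?]; lra.
pose d := Num.min 1 (e * \det (g p)).
have d0 : 0 < d by rewrite lt_min ltr01 mulr_gt0.
have [N _ HN] : \forall k \near \oo, `|a - u k| < d.
  by move/cvgrPdist_lt : ua; apply.
exists N; rewrite detE ltr_pdivrMr //.
have := HN N (leqnn N); rewrite /= a0 sub0r normrN gtr0_norm //.
rewrite lt_min => /andP[uN1 uNe]; apply: le_lt_trans uNe.
by rewrite -[leRHS]expr1 ler_wiXn2l // ltW.
Qed.

End almost_everywhere_limits.

(** * Uniqueness of the limit *)

Section omega_limits.
Variables (R : realType) (n : nat) (M : closedManifold R n).
Implicit Types (i : 'I_(atlas_size M)) (g s : tensor_field M) (N : set M).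
Notation leb := (lebesgue_tuple R n).

Lemma nullsetS g N N' : N `<=` N' -> nullset g N' -> nullset g N.
Proof. by move=> NN' [B [bB B0 N'B]]; exists B; split=> // x /NN' /N'B. Qed.

Lemma nullset0 g : metrics g -> nullset g set0.
Proof.
move=> gm; apply/(nullsetP _ gm) => i.
by rewrite preimage_set0 setI0; exact: negligible_set0.
Qed.

Lemma nullsetU g N N' : metrics g -> nullset g N -> nullset g N' ->
  nullset g (N `|` N').
Proof.
move=> gm /(nullsetP _ gm) H /(nullsetP _ gm) H'; apply/(nullsetP _ gm) => i.
by rewrite preimage_setU setIUr; exact: negligibleU.
Qed.

Lemma aeM_piece g (P : M -> Prop) i : metrics g -> aeM g P ->
  {ae leb, forall x, tuple_piece i x -> P (chart_point i x)}.
Proof.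
move=> gm /(nullsetP _ gm) /(_ i).
by apply: negligibleS => x /= /not_implyP.
Qed.

Lemma piece_aeM g (P : M -> Prop) : metrics g ->
  (forall i, {ae leb, forall x, tuple_piece i x -> P (chart_point i x)}) ->
  aeM g P.
Proof.
move=> gm H; apply/(nullsetP _ gm) => i.
by apply: negligibleS (H i) => x /= [ix nP] /(_ ix).
Qed.

Lemma semimetric_eq_refl g s : metrics g -> semimetric_eq g s s.
Proof.
move=> gm; split.
  by apply: nullsetS (nullset0 gm) => x [[]|[]].
by apply: nullsetS (nullset0 gm) => x /=; apply.
Qed.

Lemma semimetric_eq_sym g s s' : semimetric_eq g s s' -> semimetric_eq g s' s.
Proof.
move=> [H1 H2]; split; first by rewrite setYC.
apply: nullsetS H2 => x /= H; contradict H => nd; apply/esym/H => d.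
by apply: nd; rewrite or_comm.
Qed.

Lemma semimetric_eq_trans g s s' s'' : metrics g ->
  semimetric_eq g s s' -> semimetric_eq g s' s'' -> semimetric_eq g s s''.
Proof.
move=> gm [H1 H2] [H3 H4].
have H13 := nullsetU gm H1 H3; split.
  apply: nullsetS H13 => x [[ds ds'']|[ds'' ds]].
    by have [ds'|ds'] := pselect (deflated s' x); [right; left|left; left].
  by have [ds'|ds'] := pselect (deflated s' x); [left; right|right; right].
apply: nullsetS (nullsetU gm H13 (nullsetU gm H2 H4)) => x /= /not_implyP[nd ne].
have [ds'|ds'] := pselect (deflated s' x).
  by left; left; right; split=> // ds; apply: nd; left.
have [e1|e1] := pselect (s x = s' x); last first.
  by right; left => /= H; apply: e1; apply: H => -[ds|//]; apply: nd; left.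
right; right => /= H; apply: ne; rewrite e1; apply: H => -[//|ds''].
by apply: nd; right.
Qed.

Lemma semimetric_class_eq g s s' : metrics g -> semimetric_eq g s s' ->
  semimetric_class g s = semimetric_class g s'.
Proof.
move=> gm ss'; apply/seteqP; split=> r [rm rs]; split=> //.
  exact: semimetric_eq_trans ss'.
exact: semimetric_eq_trans (semimetric_eq_sym ss').
Qed.

(** Both limits of the probe at 0 agree, and they vanish exactly at the deflated
points. At the other points the two sequences converge to positive definite
matrices on which all probes agree. *)
Lemma pointwise_limits_eq g gk0 gk1 s0 s1 (p : M) : metrics g ->
  (forall k, metrics (gk0 k)) -> (forall k, metrics (gk1 k)) ->
  (s0 p)^T = s0 p -> (s1 p)^T = s1 p ->
  cvgn (fun k => probe 0 (gk0 k p)) -> cvgn (fun k => probe 0 (gk1 k p)) ->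
  limn_einf (fun k => `|probe 0 (gk1 k p) - probe 0 (gk0 k p)|%:E) = 0%E ->
  (forall j l, limn_einf (fun k =>
    `|probe (delta_mx 0 j + delta_mx 0 l) (gk1 k p) -
      probe (delta_mx 0 j + delta_mx 0 l) (gk0 k p)|%:E) = 0%E) ->
  (deflated s0 p <-> deflated_seq g gk0 p) ->
  (deflated s1 p <-> deflated_seq g gk1 p) ->
  (~ deflated_seq g gk0 p -> gk0 k p @[k --> \oo] --> s0 p) ->
  (~ deflated_seq g gk1 p -> gk1 k p @[k --> \oo] --> s1 p) ->
  (deflated s0 p <-> deflated s1 p) /\ (~ deflated s0 p -> s0 p = s1 p).
Proof.
move=> gm m0 m1 sym0 sym1 /cvg_ex[a ua] /cvg_ex[b wb] lim0 limv D0 D1 cvg0 cvg1.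
have ab := lim_eq_of_liminf ua wb lim0.
have DD : deflated s0 p <-> deflated s1 p.
  rewrite D0 D1 (deflated_seqP gm m0 ua) (deflated_seqP gm m1 wb) ab.
  by [].
split=> // nd0; have nd1 : ~ deflated s1 p by rewrite -DD.
have p0 : posdef (s0 p) by exact: contrapT.
have p1 : posdef (s1 p) by exact: contrapT.
have c0 : gk0 k p @[k --> \oo] --> s0 p by apply: cvg0; rewrite -D0.
have c1 : gk1 k p @[k --> \oo] --> s1 p by apply: cvg1; rewrite -D1.
have probe_eq v : limn_einf (fun k =>
    `|probe v (gk1 k p) - probe v (gk0 k p)|%:E) = 0%E ->
    probe v (s0 p) = probe v (s1 p).
  move=> lim; apply: lim_eq_of_liminf lim.
    exact: (cvg_comp _ _ c0 (probe_continuous p0)).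
  exact: (cvg_comp _ _ c1 (probe_continuous p1)).
apply: probe_inj => //; first exact: probe_eq.
by move=> j l; exact: probe_eq.
Qed.

End omega_limits.

Theorem theorem4p27 (R : realType) (n : nat) (M : closedManifold R n)
    (M_orientable : orientable M)
    (g : tensor_field M) (g_metric : metrics g)
    (gk0 gk1 : nat -> tensor_field M)
    (gk0_metric : forall k, metrics (gk0 k))
    (gk1_metric : forall k, metrics (gk1 k))
    (C0 C1 : set (tensor_field M))
    (gk0_cvg : omega_cvg g gk0 C0)
    (gk1_cvg : omega_cvg g gk1 C1)
    (gk_equiv : l2_dist (gk0 k) (gk1 k) @[k --> \oo] --> 0%E) :
  C0 = C1.
Proof.
have [[s0 s0m <-] lim0] := gk0_cvg.
have [[s1 s1m <-] lim1] := gk1_cvg.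
have [_ D0 cvg0 sum0] := lim0 s0 (conj s0m (semimetric_eq_refl s0 g_metric)).
have [_ D1 cvg1 sum1] := lim1 s1 (conj s1m (semimetric_eq_refl s1 g_metric)).
have deflatedP s gk : nullset g (deflated s `+` deflated_seq g gk) ->
    aeM g (fun x => deflated s x <-> deflated_seq g gk x).
  apply: nullsetS => x /= nE.
  have [ds|ds] := pselect (deflated s x); have [dg|dg] := pselect (deflated_seq g gk x).
  - by exfalso; apply: nE.
  - by left.
  - by right.
  - by exfalso; apply: nE; split.
have ae_eq : aeM g (fun x => (deflated s0 x <-> deflated s1 x) /\
    (~ deflated s0 x -> s0 x = s1 x)).
  apply: piece_aeM => // i.
  have D0i := aeM_piece i g_metric (deflatedP _ _ D0).
  have D1i := aeM_piece i g_metric (deflatedP _ _ D1).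
  have cvg0i := aeM_piece i g_metric cvg0.
  have cvg1i := aeM_piece i g_metric cvg1.
  have u0 := ae_piece (fun Y mY Yi Yoo =>
    ae_probe_cvg mY Yi Yoo gk0_metric sum0).
  have u1 := ae_piece (fun Y mY Yi Yoo =>
    ae_probe_cvg mY Yi Yoo gk1_metric sum1).
  have probe_lim v := ae_piece (fun Y mY Yi Yoo =>
    ae_probe_liminf mY Yi Yoo v gk0_metric gk1_metric gk_equiv).
  have probes_lim : {ae lebesgue_tuple R n, forall x, forall jl : 'I_n * 'I_n,
      tuple_piece i x -> limn_einf (fun k =>
    `|probe (delta_mx 0 jl.1 + delta_mx 0 jl.2) (gk1 k (chart_point i x)) -
      probe (delta_mx 0 jl.1 + delta_mx 0 jl.2) (gk0 k (chart_point i x))|%:E)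
      = 0%E}.
    by apply: filter_forall => jl; exact: probe_lim.
  have probe0_lim := probe_lim i 0.
  apply: filterS (filterI (filterI (filterI (u0 i) (u1 i)) (filterI probe0_lim
    probes_lim)) (filterI (filterI D0i D1i) (filterI cvg0i cvg1i))) =>
    x [[[u0x u1x] [lim0x limx]] [[d0x d1x] [c0x c1x]]] ix.
  apply: (@pointwise_limits_eq _ _ _ g gk0 gk1) => //.
  - by have [psd _] := s0m; have [] := psd (chart_point i x).
  - by have [psd _] := s1m; have [] := psd (chart_point i x).
  - exact: u0x.
  - exact: u1x.
  - exact: lim0x.
  - by move=> j l; exact: (limx (j, l)).
  - exact: d0x.
  - exact: d1x.
  - exact: c0x.
  - exact: c1x.
have [rsd rse] : nullset g (deflated s0 `+` deflated s1) /\
    aeM g (fun x => ~ (deflated s0 `|` deflated s1) x -> s0 x = s1 x).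
  split; apply: nullsetS ae_eq => x /=.
    by move=> [[d0 d1]|[d1 d0]] [dd _]; [apply: d1; rewrite -dd|apply: d0; rewrite dd].
  by move=> /not_implyP[nd ne] [_ /(_ _)]; apply: contra_not ne; apply => d0; apply: nd; left.
exact: semimetric_class_eq.
Qed.
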